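(* Let $(V,c)$ be a finite-dimensional rigid braided vector space over $\mathbb C$. (1) Let $r\ge2$ and suppose that $\widehat{\mathfrak B}_r(V)$ vanishes in degree $2r+1$. Then $\widehat{\mathfrak B}_r(V)=\mathfrak B(V)$. (2) Let $J\subseteq\ker(T(V)\to\mathfrak B(V))$ be a homogeneous ideal which is also a coideal and is compatible with the braiding. Suppose that $T(V)/J$ is finite dimensional, that it has top degree $n$, and that $\dim\mathfrak B^n(V)\ne0$. Then $T(V)/J=\mathfrak B(V)$. (3) Let $r\ge2$ and suppose that $\widehat{\mathfrak B}_r(V)$ is finite dimensional, has top degree $n$, and $\dim\mathfrak B^n(V)\ne0$. Then $\widehat{\mathfrak B}_r(V)=\mathfrak B(V)$.
   Context: A braided vector space is a pair $(V,c)$ with $c\in\mathrm{Aut}(V\otimes V)$ satisfying $(c\otimes\mathrm{id})(\mathrm{id}\otimes c)(c\otimes\mathrm{id})=(\mathrm{id}\otimes c)(c\otimes\mathrm{id})(\mathrm{id}\otimes c)$. It is rigid if the map $c^\flat:V^*\otimes V\to V\otimes V^*$, $c^\flat=(\mathrm{ev}_V\otimes\mathrm{id}_{V\otimes V^*})(\mathrm{id}_{V^*}\otimes c\otimes\mathrm{id}_{V^*})(\mathrm{id}_{V^*\otimes V}\otimes\mathrm{ev}_V^* )$, is an isomorphism. The braid group $\mathbb B_n$ with standard generators $\sigma_i$ acts on $T^n(V)=V^{\otimes n}$, $\sigma_i$ acting by $c$ in positions $i,i+1$. The braiding $c$ extends to a braiding of $T(V)$, and $T(V)$ is a graded braided Hopf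 algebra in which the elements of $V$ are primitive (the comultiplication being multiplicative for the algebra structure on $T(V)\otimes T(V)$ twisted by the braiding). Let $\tau_i$ be the standard generators of the symmetric group $\mathbb S_n$, and let $M:\mathbb S_n\to\mathbb B_n$ be the Matsumoto section: $M(x)=\sigma_{i_1}\cdots\sigma_{i_l}$ for any shortest expression $x=\tau_{i_1}\cdots\tau_{i_l}$. Put $Q_n=\sum_{x\in\mathbb S_n}M(x)$, acting on $T^n(V)$. The Nichols algebra is the graded algebra $\mathfrak B(V)=\bigoplus_{n\ge0}\mathfrak B^n(V)=\mathbb C\oplus V\oplus\bigoplus_{n\ge2}T^n(V)/\ker Q_n$, a quotient of $T(V)$. For $r\ge2$ let $J_r$ be the ideal of $T(V)$ generated by $\bigoplus_{i=2}^r\ker(Q_i)$, and $\widehat{\mathfrak B}_r(V)=T(V)/J_r$; it projects onto $\mathfrak B(V)$, and ''$\widehat{\mathfrak B}_r(V)=\mathfrak B(V)$'' means that this projection is an isomorphism (similarly for $T(V)/J$). A subspace $J\subseteq T(V)$ is compatible with the braiding if $c(V\otimes J)=J\otimes V$ and $c(J\otimes V)=V\otimes J$. The top degree of a non-zero finite-dimensional graded algebra $R=\bigoplus_{m\ge0}R^m$ is the largest $n$ with $R^n\ne0$. *)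

(* Defs.v *)
From HB Require Import structures.
From mathcomp Require Import all_boot all_order all_fingroup all_algebra.
From mathcomp Require Import classical_sets.
From mathcomp Require Import xfinmap monalg.

Set Implicit Arguments.
Unset Strict Implicit.
Unset Printing Implicit Defensive.

Import GRing.Theory.

Local Open Scope classical_set_scope.
Local Open Scope ring_scope.

(** * Tensor products of two finite-dimensional vector spaces

    [tensor F U W] is written in coordinates: the entry [i j] of a matrix is the
    coefficient of the tensor product of the [i]-th and [j]-th vectors of the
    bases [vbasis] of [U] and [W].  Together with [tens] it has the universal
    property of the tensor product ([tens_bilinear], [tlift_tens],
    [tlift_unique]). *)
Notation tensor F U W := 'M[F]_(\dim {: U}, \dim {: W}).

Section TensorProduct.
Variables (F : fieldType) (U W : vectType F).

Definition basis_vec (V : vectType F) (i : 'I_(\dim {:V})) : V :=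
  (vbasis {:V})`_i.

Definition basis_coord (V : vectType F) (i : 'I_(\dim {:V})) (v : V) : F :=
  coord (vbasis {:V}) i v.

Definition tens (u : U) (w : W) : tensor F U W :=
  \matrix_(i, j) (basis_coord i u * basis_coord j w).

Definition bilinear_map (X : lmodType F) (b : U -> W -> X) : Prop :=
  (forall w a u u', b (a *: u + u') w = a *: b u w + b u' w) /\
  (forall u a w w', b u (a *: w + w') = a *: b u w + b u w').

(* The linear map on the tensor product induced by a bilinear map. *)
Definition tlift (X : lmodType F) (b : U -> W -> X)
    (t : tensor F U W) : X :=
  \sum_i \sum_j t i j *: b (basis_vec i) (basis_vec j).

Lemma basis_vecE (V : vectType F) (v : V) :
  v = \sum_i basis_coord i v *: basis_vec i.
Proof. exact: (coord_vbasis (memvf v)). Qed.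

Lemma tens_bilinear : bilinear_map (tens : U -> W -> tensor F U W).
Proof.
split=> [w a u u'|u a w w']; apply/matrixP=> i j; rewrite !mxE /basis_coord linearP /=.
  by rewrite mulrDl mulrA.
by rewrite mulrDr mulrCA.
Qed.

Lemma tlift_linear (X : lmodType F) (b : U -> W -> X) : linear (tlift b).
Proof.
move=> a s t; rewrite /tlift scaler_sumr -big_split /=; apply: eq_bigr => i _.
rewrite scaler_sumr -big_split /=; apply: eq_bigr => j _.
by rewrite !mxE scalerDl scalerA.
Qed.

Lemma tlift_tens (X : lmodType F) (b : U -> W -> X) (u : U) (w : W) :
  bilinear_map b -> tlift b (tens u w) = b u w.
Proof.
move=> [bl br].
have bl0 w' : b 0 w' = 0.
  by have := bl w' (-1) 0 0; rewrite scaler0 addr0 scaleN1r addNr.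
have br0 u' : b u' 0 = 0.
  by have := br u' (-1) 0 0; rewrite scaler0 addr0 scaleN1r addNr.
have blS n (a : 'I_n -> F) (x : 'I_n -> U) w' :
    b (\sum_i a i *: x i) w' = \sum_i a i *: b (x i) w'.
  by apply: (big_rec2 (fun y z => b y w' = z)) => // i y z _ <-; rewrite bl.
have brS n (a : 'I_n -> F) (x : 'I_n -> W) u' :
    b u' (\sum_i a i *: x i) = \sum_i a i *: b u' (x i).
  by apply: (big_rec2 (fun y z => b u' y = z)) => // i y z _ <-; rewrite br.
rewrite {2}(basis_vecE u) {2}(basis_vecE w) blS; apply: eq_bigr => i _.
rewrite brS scaler_sumr; apply: eq_bigr => j _.
by rewrite mxE scalerA.
Qed.

Lemma tlift_unique (X : lmodType F) (f : tensor F U W -> X) :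
  linear f -> f =1 tlift (fun u w => f (tens u w)).
Proof.
move=> flin t.
have f0 : f 0 = 0.
  by have := flin (-1) 0 0; rewrite scaler0 addr0 scaleN1r addNr.
have fS n (a : 'I_n -> F) x : f (\sum_i a i *: x i) = \sum_i a i *: f (x i).
  by apply: (big_rec2 (fun y z => f y = z)) => // i y z _ <-; rewrite flin.
have fD n (x : 'I_n -> _) : f (\sum_i x i) = \sum_i f (x i).
  apply: (big_rec2 (fun y z => f y = z)) => // i y z _ <-.
  by rewrite -[x i]scale1r flin !scale1r.
have crd (V : vectType F) (i j : 'I_(\dim {:V})) :
    basis_coord i (basis_vec j) = (i == j)%:R.
  by rewrite /basis_coord /basis_vec coord_free ?(basis_free (vbasisP _)) // eq_sym.
rewrite {1}(matrix_sum_delta t) fD; apply: eq_bigr => i _.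
rewrite fS; apply: eq_bigr => j _; congr (_ *: f _).
by apply/matrixP=> k l; rewrite !mxE !crd mulrC -natrM mulnb andbC.
Qed.

End TensorProduct.

(** * Reduced expressions in symmetric groups *)
Section Matsumoto.
Variable n : nat.

Fact tau_subproof (i : 'I_n.-1) : (i.+1 < n)%N.
Proof. by rewrite -ltn_predRL. Qed.

(* The adjacent transposition exchanging [i] and [i + 1], positions being
   counted from 0. *)
Definition tau (i : 'I_n.-1) : 'S_n :=
  tperm (widen_ord (leq_pred n) i) (Ordinal (tau_subproof i)).

Definition word_perm (s : seq 'I_n.-1) : 'S_n := (\prod_(i <- s) tau i)%g.

Definition has_expression (x : 'S_n) (l : nat) : bool :=
  [exists s : l.-tuple 'I_n.-1, word_perm s == x].

Lemma has_expressionT (x : 'S_n) : exists l, has_expression x l.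
Proof.
suff [s <-] : exists s, word_perm s = x.
  by exists (size s); apply/existsP; exists (in_tuple s).
have wM s t : word_perm (s ++ t) = (word_perm s * word_perm t)%g.
  by rewrite /word_perm big_cat.
have tr d (i j : 'I_n) : (j = i + d :> nat)%N -> exists s, word_perm s = tperm i j.
  elim: d i j => [|d IHd] i j ij.
    exists [::]; rewrite /word_perm big_nil.
    have -> : j = i by apply: val_inj; rewrite /= ij addn0.
    by rewrite tperm1.
  have jn : (j.-1 < n)%N by rewrite (leq_ltn_trans (leq_pred _) (ltn_ord j)).
  have [|s sE] := IHd i (Ordinal jn); first by rewrite /= ij addnS.
  have jn' : (j.-1 < n.-1)%N.
    by rewrite ltn_predRL prednK ?ltn_ord // ij addnS.
  pose k := Ordinal jn'.
  have tk : tau k = tperm (Ordinal jn) j.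
    by congr tperm; apply: val_inj => //=; rewrite ij addnS.
  case: (posnP d) => [d0|d_gt0].
    exists [:: k]; rewrite /word_perm big_seq1 tk.
    by congr tperm; apply: val_inj; rewrite /= ij d0 addnS addn0.
  exists (k :: s ++ [:: k]); rewrite /word_perm big_cons -/(word_perm _) wM.
  rewrite sE /word_perm big_seq1 tk -[X in (X * _)%g]tpermV mulgA -mulgA.
  have -> : tperm i j = (tperm i (Ordinal jn) ^ tperm (Ordinal jn) j)%g.
    have iNj : i != j by rewrite -val_eqE /= ij -[X in X == _]addn0 eqn_add2l.
    have iNj' : i != Ordinal jn.
      by rewrite -val_eqE /= ij addnS /= -[X in X == _]addn0 eqn_add2l eq_sym -lt0n.
    by rewrite tpermJ tpermL tpermD // eq_sym.
  by rewrite conjgE mulgA.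
have [ts -> _] := prod_tpermP x.
elim: ts => [|[i j] ts [s IHs]]; first by exists [::]; rewrite /word_perm !big_nil.
have [t tE] : exists t, word_perm t = tperm i j.
  case: (leqP i j) => [ij|/ltnW ij]; last rewrite tpermC.
    by apply: (tr (j - i)%N); rewrite subnKC.
  by apply: (tr (i - j)%N); rewrite subnKC.
by exists (t ++ s); rewrite wM tE IHs big_cons.
Qed.

Definition perm_length (x : 'S_n) : nat := ex_minn (has_expressionT x).

Fact reduced_word_subproof (x : 'S_n) : has_expression x (perm_length x).
Proof. by rewrite /perm_length; case: ex_minnP. Qed.

(* A shortest expression of [x]; the Matsumoto section maps [x] to the
   corresponding product of generators of the braid group, which does not
   depend on the choice made here.  The product of ['S_n] is composition
   written from left to right, so that with respect to the opposite convention
   [x] is replaced with its inverse; this does not affect sums over ['S_n]. *)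
Definition reduced_word (x : 'S_n) : seq nat :=
  [seq val i | i <- xchoose (existsP (reduced_word_subproof x))].

End Matsumoto.

(** * The tensor algebra of a braided vector space

    [T(V)] is the algebra of the free monoid on the basis [vbasis] of [V],
    [T(V) (x) T(V)] is the free module on pairs of words. *)
Notation word V := {fmonom 'I_(\dim {: V})}.
Notation tensor_alg F V := {malg F[word V]}.
Notation tensor_alg2 F V := {malg F[(word V * word V)%type]}.

Section TensorAlgebra.
Variables (F : fieldType) (V : vectType F).

Local Notation I := 'I_(\dim {:V}).
Local Notation W := (word V).
Local Notation T := (tensor_alg F V).
Local Notation TT := (tensor_alg2 F V).

(* Linear extension of a function defined on basis elements. *)
Definition linext (K : choiceType) (X : lmodType F) (h : K -> X)
    (x : {malg F[K]}) : X := \sum_(k <- msupp x) x@_k *: h k.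

Definition inT (v : V) : T := \sum_(i : I) basis_coord i v *: << FMonom [:: i] >>.

Definition inT2 : tensor F V V -> T :=
  tlift (fun u v : V => inT u * inT v).

Definition tensT (x y : T) : TT :=
  linext (fun u => linext (fun v => << (u, v) >> : TT) y) x.

Definition component (n : nat) (x : T) : T :=
  \sum_(w <- msupp x | size w == n) << x@_w *g w >>.

Definition Tpow (n : nat) : set T := [set x | component n x = x].

Definition direct_sum (P : nat -> set T) : set T :=
  [set x | forall n, P n (component n x)].

Definition subspace (X : lmodType F) (J : set X) : Prop :=
  J 0 /\ forall a x y, J x -> J y -> J (a *: x + y).

Definition ideal (J : set T) : Prop :=
  subspace J /\ forall x y, J y -> J (x * y) /\ J (y * x).

Definition ideal_gen (S : set T) : set T :=
  [set x | forall J, ideal J -> S `<=` J -> J x].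

Definition homogeneous (J : set T) : Prop :=
  forall n x, J x -> J (component n x).

(* The subspace [A (x) B] of [T(V) (x) T(V)]. *)
Definition tens_set (A B : set T) : set TT :=
  [set z | exists (n : nat) (x y : 'I_n -> T),
     [/\ forall i, A (x i), forall i, B (y i) & z = \sum_i tensT (x i) (y i)]].

(* Quotients [T(V)/J] are handled through congruence modulo [J]. *)
Definition congr_mod (J : set T) (x y : T) : Prop := J (x - y).

(* The identity of [T(V)] induces an isomorphism [T(V)/J -> T(V)/K]; from left
   to right the equivalence says that the map exists, from right to left that
   it is injective (it is always surjective). *)
Definition projection_iso (J K : set T) : Prop :=
  forall x y, congr_mod J x y <-> congr_mod K x y.

Definition quotient_findim (J : set T) : Prop :=
  exists (n : nat) (b : 'I_n -> T),
    forall x, exists a : 'I_n -> F, congr_mod J x (\sum_i a i *: b i).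

(* The component of degree [n] of [T(V)/J], the image of [T^n(V)], is zero. *)
Definition quotient_vanishes (J : set T) (n : nat) : Prop :=
  forall x, Tpow n x -> congr_mod J x 0.

Definition quotient_top_degree (J : set T) (n : nat) : Prop :=
  ~ quotient_vanishes J n /\
  forall m, ~ quotient_vanishes J m -> (m <= n)%N.

Section Braiding.
Variable c : 'End(tensor F V V).

Local Notation dual := 'Hom(V, F^o).

(* The action of the [i]-th generator of the braid group, that is [c] in the
   positions [i] and [i + 1] counted from 0 (junk: the identity, on words that
   are too short). *)
Definition sigma (i : nat) : T -> T := linext (fun w : W =>
  if drop i w is a :: b :: s then
    << FMonom (take i w) >> * inT2 (c (tens (basis_vec a) (basis_vec b)))
      * << FMonom s >>
  else << w >>).

(* [:: i1; ..; il] acts as [sigma i1 \o .. \o sigma il]. *)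
Definition braid_act (s : seq nat) (x : T) : T := foldr sigma x s.

Definition braided : Prop :=
  bijective c /\
  forall x, Tpow 3 x ->
    sigma 0 (sigma 1 (sigma 0 x)) = sigma 1 (sigma 0 (sigma 1 x)).

(* f (x) v |-> \sum_k (ev (x) id) (f (x) c (v (x) e_k)) (x) e^k *)
Definition flat (t : tensor F dual V) : tensor F V dual :=
  tlift (fun (f : dual) (v : V) =>
    \sum_(k : I) tens
      (tlift (fun x y : V => (f x : F) *: y) (c (tens v (basis_vec k))))
      (linfun (basis_coord k : V -> F^o) : dual)) t.

Definition rigid : Prop := bijective flat.

Definition qsym (n : nat) (x : T) : T :=
  \sum_(p : 'S_n) braid_act (reduced_word p) x.

Definition ker_qsym (n : nat) : set T := [set x | Tpow n x /\ qsym n x = 0].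

(* The kernel of the projection from [T(V)] to the Nichols algebra. *)
Definition nichols_ideal : set T :=
  direct_sum (fun n => if (2 <= n)%N then ker_qsym n else [set 0]).

Definition approx_ideal (r : nat) : set T :=
  ideal_gen
    (direct_sum (fun n => if (2 <= n <= r)%N then ker_qsym n else [set 0])).

(* The braiding of [T^m(V)] with [T^n(V)]: the last letter of the left word
   first moves through the right word, and so on until the first letter. *)
Definition block_braid (m n : nat) : seq nat :=
  flatten [seq rev (iota j n) | j <- iota 0 m].

Definition split_at (n : nat) : T -> TT :=
  linext (fun w : W => << (FMonom (take n w), FMonom (drop n w)) >>).

Definition braidT : TT -> TT := linext (fun p : W * W =>
  split_at (size p.2)
    (braid_act (block_braid (size p.1) (size p.2)) << mmul p.1 p.2 >>)).

(* (m (x) m) (id (x) c (x) id) *)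
Definition mulTT (x y : TT) : TT :=
  linext (fun p : W * W => linext (fun q : W * W =>
    linext (fun r : W * W => << (mmul p.1 r.1, mmul r.2 q.2) >> : TT)
      (braidT << (p.2, q.1) >>)) y) x.

Definition comul : T -> TT := linext (fun w : W =>
  foldr (fun i => mulTT (tensT << FMonom [:: i] >> 1 + tensT 1 << FMonom [:: i] >>))
    (tensT 1 1) w).

Definition counit (x : T) : F := x@_mone.

Definition coideal (J : set T) : Prop :=
  [/\ subspace J, forall x, J x -> counit x = 0 &
      forall x, J x -> exists y z,
        [/\ tens_set J setT y, tens_set setT J z & comul x = y + z]].

Definition braid_compatible (J : set T) : Prop :=
  braidT @` tens_set (Tpow 1) J = tens_set J (Tpow 1) /\
  braidT @` tens_set J (Tpow 1) = tens_set (Tpow 1) J.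

End Braiding.
End TensorAlgebra.

(* Main.v *)
Require Import Defs.
From HB Require Import structures.
From mathcomp Require Import all_boot all_order all_fingroup all_algebra.
From mathcomp Require Import classical_sets reals complex.
From mathcomp Require Import finmap monalg boolp zify.

(** Let N be the kernel of the projection from T(V) to the Nichols algebra and
    K_n = ker Q_n, so that N is the direct sum of the K_n.  The proof rests on
    skew derivations.  Bring, with the braiding, each letter of a tensor in
    turn to the last place, add up, and split off the last letter: this gives
    an operator d_a : T^(n+1) -> T^n for each basis vector a of V, and d_a (x)
    is the coefficient of a in the component of the comultiplication of x in
    T(V) (x) V.  There is a twisted Leibniz rule ([derM])

      d_a (x y) = x d_a (y) + sum_d d_d (x) cross_(a,d) (y),

    where cross_(a,d) (y) is the coefficient of a in the last place after the
    letter d has passed through y.  Writing each permutation of n + 1 letters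
    as a permutation of the first n ones times a cycle that brings one letter
    to the end gives Q_(n+1) (x) = sum_a Q_n (d_a x) a ([symmetrizerS]).  Hence
    x of degree n + 1 lies in K_(n+1) iff all d_a (x) lie in K_n ([qkerS]).

    The heart of the proof is [mul_mem_qker]: let J be an ideal stable under
    the d_a, and let x be an element outside J such that all d_a (x) are in J;
    if y is homogeneous of degree n and x y is in J, then y is in K_n.  Indeed
    d_a (x y) is congruent to x d_a (y) modulo J, so that induction on n
    applies to the d_a (y), until y is a constant.

    In the three parts of the theorem J is contained in N, and equality has to
    be shown.  If it fails, let x be an element of some K_m outside J, with m
    minimal; then d_a (x) is in K_(m-1), hence in J.  So it is enough to find
    a homogeneous y outside N for which the degree of x y forces x y into J.
    If J = J_r contains T^(2r+1), then m > r, and any y of degree r outside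
    K_r will do, since x y has degree at least 2r + 1; if K_r were all of T^r,
    then J_r would contain T^m.  If T(V)/J has top degree n and B^n is not
    zero, then any y of degree n outside K_n will do ([qker_sub_top]).

    It remains to see that J is stable under the d_a.  For a coideal contained
    in N this is read off from the comultiplication, because J has no element
    with a non-zero part of degree one ([coideal_der_closed]).  For J_r, the
    generators are stable under the d_a by the above and under the
    cross_(a,b) because the braiding commutes with the Q_n; the product rules
    for both kinds of operators carry this over to the ideal that they
    generate ([generated_closed]).  The same argument shows that J_r is
    contained in N, since every subspace that is stable under the d_a and
    whose elements have no constant term lies in N ([der_closed_sub_qker]). *)

Set Implicit Arguments.
Unset Strict Implicit.
Unset Printing Implicit Defensive.

Import GRing.Theory.

(** * Normal forms of words in the braid generators *)

Section Words.

(** Rewriting towards a normal form: the far commutations go both ways, the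
    braid relation from left to right. *)
Inductive braid_rewrites : seq nat -> seq nat -> Prop :=
| Braid_refl s : braid_rewrites s s
| Braid_trans s t u : braid_rewrites s t -> braid_rewrites t u -> braid_rewrites s u
| Braid_far u v i j : (i.+1 < j) || (j.+1 < i) ->
    braid_rewrites (u ++ [:: i, j & v]) (u ++ [:: j, i & v])
| Braid_near u v i :
    braid_rewrites (u ++ [:: i.+1, i, i.+1 & v]) (u ++ [:: i, i.+1, i & v]).

Lemma braid_rewrites_cat u v s t :
  braid_rewrites s t -> braid_rewrites (u ++ s ++ v) (u ++ t ++ v).
Proof.
elim=> {s t} [s|s t w _ IHs _ IHt|a b i j ij|a b i]; first exact: Braid_refl.
- exact: Braid_trans IHs IHt.
- by rewrite -!catA /= !(catA u); apply: Braid_far.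
- by rewrite -!catA /= !(catA u); apply: Braid_near.
Qed.

Lemma braid_rewrites_catl u s t : braid_rewrites s t -> braid_rewrites (u ++ s) (u ++ t).
Proof. by move/(braid_rewrites_cat u [::]); rewrite !cats0. Qed.

Lemma braid_rewrites_catr v s t : braid_rewrites s t -> braid_rewrites (s ++ v) (t ++ v).
Proof. by move/(braid_rewrites_cat [::] v). Qed.

Lemma braid_rewrites_size s t : braid_rewrites s t -> size s = size t.
Proof. by elim=> // [? ? ? _ -> _ ->|? ? ? ? _|? ? ?] //; rewrite !size_cat. Qed.

Lemma braid_rewrites_all (P : pred nat) s t : braid_rewrites s t -> all P s = all P t.
Proof.
elim=> // [? ? ? _ -> _ ->|? ? i j _|? ? i] //; rewrite !all_cat /=; congr (_ && _).
  by rewrite andbCA.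
by case: (P i.+1); case: (P i).
Qed.

(** The word n-1, .., p.  As an operator on n + 1 letters it carries the letter
    in position p to the last place, [sigma p] acting first. *)
Definition descent (n p : nat) : seq nat := rev (iota p (n - p)).

Lemma descentnn n : descent n n = [::].
Proof. by rewrite /descent subnn. Qed.

Lemma descent_rcons n p : p < n -> descent n p = rcons (descent n p.+1) p.
Proof. by move=> pn; rewrite /descent -(subnSK pn) /= rev_cons. Qed.

Lemma descent_cons n p : p <= n -> descent n.+1 p = n :: descent n p.
Proof.
by move=> pn; rewrite /descent subSn // -addn1 iotaD rev_cat subnKC.
Qed.

Lemma mem_descent n p i : (i \in descent n p) = (p <= i < n).
Proof. by rewrite mem_rev mem_iota; case: (leqP p n); lia. Qed.

Lemma braid_rewrites_far i s :
  all (fun j => (i.+1 < j) || (j.+1 < i)) s -> braid_rewrites (rcons s i) (i :: s).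
Proof.
elim: s => [|j s IHs] /=; first by move=> _; exact: Braid_refl.
move=> /andP[ij /IHs si]; apply: Braid_trans (Braid_far [::] s _) => /=.
  exact: (braid_rewrites_catl [:: j] si).
by rewrite orbC.
Qed.

(** The letters i and i-1 of the descent are adjacent, and the next letter i
    of the product is adjacent to them once it has moved past the smaller
    ones; the braid relation turns i, i-1, i into i-1, i, i-1. *)
Lemma descent_past n p i : p < i < n ->
  braid_rewrites (rcons (descent n p) i) (i.-1 :: descent n p).
Proof.
elim: n => [|n IHn] /andP[pi]; first by rewrite ltn0.
rewrite ltnS leq_eqVlt => /predU1P[i_n|ltin].
  rewrite descent_cons; last by rewrite -i_n ltnW.
  case: i => // i in IHn pi i_n *; rewrite -i_n descent_cons //=.
  apply: Braid_trans (Braid_near [::] _ _) => /=.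
  apply: (braid_rewrites_catl [:: i.+1; i]); apply: braid_rewrites_far.
  by apply/allP => j; rewrite mem_descent; lia.
rewrite descent_cons; last by lia.
apply: Braid_trans (Braid_far [::] _ _) => /=; last by lia.
by apply: (braid_rewrites_catl [:: n]); apply: IHn; rewrite pi.
Qed.

(** Naturality of the braiding of one strand with n strands: a braid on these
    can be done before or after the first strand has moved past them. *)
Lemma descent_pass n u : all (fun i => i.+1 < n) u ->
  braid_rewrites (descent n 0 ++ map succn u) (u ++ descent n 0).
Proof.
elim: u => [_|i u IHu /= /andP[ltin /IHu uE]]; first by rewrite cats0; apply: Braid_refl.
apply: Braid_trans (braid_rewrites_catl [:: i] uE); rewrite -cat_rcons.
apply: (@braid_rewrites_catr (map succn u) _ (i :: descent n 0)).
exact: (@descent_past n 0 i.+1).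
Qed.

(** One word for each permutation: a permutation of the first letters,
    followed on the right by the cycle that brings one letter to the end. *)
Fixpoint normal_words (n : nat) : seq (seq nat) :=
  if n is m.+1 then
    [seq u ++ descent m p | u <- normal_words m, p <- iota 0 m.+1]
  else [:: [::]].

Lemma normal_wordsP n w :
  reflect (exists u p, [/\ u \in normal_words n, p <= n & w = u ++ descent n p])
    (w \in normal_words n.+1).
Proof.
apply: (iffP allpairsP) => [[[u p] [uW]]|[u [p [uW pn ->]]]].
  by rewrite mem_iota => pn ->; exists u, p.
by exists (u, p); rewrite mem_iota.
Qed.

Lemma normal_words_lt n w :
  w \in normal_words n -> all (fun i => i.+1 < n) w.
Proof.
elim: n w => [|n IHn] w; first by rewrite inE => /eqP->.
move=> /normal_wordsP[u [p [/IHn uW pn ->]]]; rewrite all_cat.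
apply/andP; split; first by apply: sub_all uW => i; lia.
by apply/allP => i; rewrite mem_descent; lia.
Qed.

Lemma size_normal_words n : size (normal_words n) = n`!.
Proof.
elim: n => // n IHn.
by rewrite (size_allpairs _ (normal_words n)) size_iota IHn factS mulnC.
Qed.

Definition has_square w := exists u i v, braid_rewrites w (u ++ [:: i, i & v]).

Lemma has_square_cat u v s : has_square s -> has_square (u ++ s ++ v).
Proof.
move=> [a [i [b sE]]]; exists (u ++ a), i, (b ++ v).
by apply: Braid_trans (braid_rewrites_cat u v sE) _; rewrite -!catA; apply: Braid_refl.
Qed.

Lemma has_square_rewrites s t : braid_rewrites s t -> has_square t -> has_square s.
Proof. by move=> st [u [i [v tE]]]; exists u, i, v; apply: Braid_trans tE. Qed.

(** Multiply a normal word u (n-1, .., p) by one more letter i.  If i is less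
    than p - 1 or greater than p, then it moves to the left of the descent,
    possibly with its index lowered, and is absorbed by u by induction on n;
    if i = p - 1, then the descent becomes longer; if i = p, then a square
    appears. *)
Lemma normal_form n w : all (fun i => i.+1 < n) w ->
  (exists2 u, u \in normal_words n & braid_rewrites w u) \/ has_square w.
Proof.
elim: n w => [|n IHn] w.
  by case: w => // _; left; exists [::] => //; exact: Braid_refl.
elim/last_ind: w => [_|w i IHw].
  have [//|[u uW uE]|[u [j [v /braid_rewrites_size]]]] := IHn [::]; last first.
    by rewrite size_cat /= addnS.
  left; exists u => //; apply/normal_wordsP; exists u, n.
  by rewrite descentnn cats0.
rewrite all_rcons => /andP[ltin /IHw[]]; last first.
  by move/(has_square_cat [::] [:: i]); rewrite cats1; right.
case=> _ /normal_wordsP[u [p [uW pn ->]]] wE.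
have {}wE : braid_rewrites (rcons w i) (u ++ rcons (descent n p) i).
  by rewrite -!cats1 catA; apply: braid_rewrites_catr.
have push k : k.+1 < n -> braid_rewrites (rcons (descent n p) i) (k :: descent n p) ->
    (exists2 u0, u0 \in normal_words n.+1 & braid_rewrites (rcons w i) u0)
      \/ has_square (rcons w i).
  move=> kn dE.
  have {}wE : braid_rewrites (rcons w i) (rcons u k ++ descent n p).
    by apply: Braid_trans wE _; rewrite cat_rcons; apply: braid_rewrites_catl.
  case: (IHn (rcons u k)); first by rewrite all_rcons kn normal_words_lt.
    case=> t tW tE; left; exists (t ++ descent n p).
      by apply/normal_wordsP; exists t, p.
    by apply: Braid_trans wE _; apply: braid_rewrites_catr.
  move/(has_square_cat [::] (descent n p)) => sq; right.
  exact: has_square_rewrites sq.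
case: (ltngtP i.+1 p) => [ip|pi|ip].
- apply: (push i); first exact: leq_trans pn.
  apply: braid_rewrites_far; apply/allP => j; rewrite mem_descent; lia.
- case: (ltngtP p i) => [pi'|/ltac:(lia)//|ip].
    apply: (push i.-1); first by lia.
    by apply: descent_past; rewrite pi'.
  right; apply: has_square_rewrites wE _; rewrite ip in pi *.
  exists (u ++ descent n i.+1), i, [::].
  rewrite descent_rcons; last by lia.
  by rewrite -!cats1 -!catA; apply: Braid_refl.
- left; exists (u ++ descent n i); last by rewrite -ip -descent_rcons in wE.
  by apply/normal_wordsP; exists u, i; split=> //; lia.
Qed.

End Words.

(** * The symmetric group: independence of the choice of reduced words *)

Lemma uniq_map_inj_in (S T : eqType) (g : S -> T) (s : seq S) :
  uniq (map g s) -> {in s &, injective g}.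
Proof.
elim: s => // x s IHs /= /andP[gx us] y z; rewrite !inE.
move=> /predU1P[->|ys] /predU1P[->|zs] // gE; last exact: IHs.
  by rewrite gE map_f in gx.
by rewrite -gE map_f in gx.
Qed.

Section SymmetricGroup.
Variable n : nat.
Local Open Scope group_scope.

(** Letters that are not indices of generators of the group are dropped. *)
Definition nat_word_perm (w : seq nat) : 'S_n := word_perm (pmap insub w).

Lemma nat_word_perm_cat u v :
  nat_word_perm (u ++ v) = nat_word_perm u * nat_word_perm v.
Proof. by rewrite /nat_word_perm pmap_cat /word_perm big_cat. Qed.

Lemma nat_word_perm_cons (i : nat) (lt_i : (i < n.-1)%N) w :
  nat_word_perm (i :: w) = tau (Ordinal lt_i) * nat_word_perm w.
Proof. by rewrite /nat_word_perm /= insubT /= /word_perm big_cons. Qed.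

Lemma nat_word_perm_val (s : seq 'I_n.-1) :
  nat_word_perm [seq val i | i <- s] = word_perm s.
Proof.
rewrite /nat_word_perm.
by have -> : pmap insub [seq val i | i <- s] = s by elim: s => //= i s ->; rewrite valK.
Qed.

Lemma tau_far (i j : 'I_n.-1) :
  ((i.+1 < j) || (j.+1 < i))%N -> tau i * tau j = tau j * tau i.
Proof.
move=> ij; rewrite [LHS]conjgC; congr (_ * _).
by rewrite /tau tpermJ !tpermD // -val_eqE /=; lia.
Qed.

(** Both sides are conjugates of a transposition, and equal to the
    transposition of the two outer letters. *)
Lemma tau_near (i j : 'I_n.-1) :
  j = i.+1 :> nat -> tau j * tau i * tau j = tau i * tau j * tau i.
Proof.
move=> ji; pose a := widen_ord (leq_pred n) i.
pose b := Ordinal (tau_subproof i); pose d := Ordinal (tau_subproof j).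
have tiE : tau i = tperm a b by [].
have tjE : tau j = tperm b d by congr tperm; apply: val_inj.
have ab : a != b by rewrite -val_eqE /=; lia.
have ad : a != d by rewrite -val_eqE /=; lia.
have bd : b != d by rewrite -val_eqE /=; lia.
rewrite tiE tjE -{1}[tperm b d]tpermV -{2}[tperm a b]tpermV -!mulgA.
rewrite -!conjgE !tpermJ !tpermL !tpermR.
by rewrite (@tpermD _ b d a) ?(@tpermD _ a b d) // eq_sym.
Qed.

Lemma braid_rewrites_perm s t : braid_rewrites s t ->
  all (fun i => i < n.-1)%N s -> nat_word_perm s = nat_word_perm t.
Proof.
elim=> {s t} [//|s t u st IHst _ IHtu sn|u v i j ij|u v i].
- by rewrite IHst ?IHtu // -(braid_rewrites_all _ st).
- rewrite all_cat !nat_word_perm_cat /= => /and4P[_ iP jP _].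
  by rewrite !nat_word_perm_cons; congr (_ * _); rewrite !mulgA tau_far.
- rewrite all_cat !nat_word_perm_cat /= => /and5P[_ jP iP jP' _].
  rewrite !nat_word_perm_cons (bool_irrelevance jP' jP).
  by congr (_ * _); rewrite !mulgA tau_near.
Qed.

Lemma reduced_word_lt (p : 'S_n) : all (fun i => i.+1 < n)%N (reduced_word p).
Proof. by rewrite all_map; apply/allP => i _ /=; rewrite -ltn_predRL. Qed.

Lemma reduced_word_perm (p : 'S_n) : nat_word_perm (reduced_word p) = p.
Proof.
rewrite nat_word_perm_val; exact/eqP/(xchooseP (existsP (reduced_word_subproof p))).
Qed.

Lemma size_reduced_word (p : 'S_n) : size (reduced_word p) = perm_length p.
Proof. by rewrite size_map size_tuple. Qed.

Lemma perm_length_le w :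
  all (fun i => i < n.-1)%N w -> (perm_length (nat_word_perm w) <= size w)%N.
Proof.
move=> wn; rewrite /perm_length; case: ex_minnP => l _; apply.
apply/existsP; have <- : size (pmap insub w : seq 'I_n.-1) = size w.
  by rewrite size_pmap_sub; apply/eqP; rewrite -all_count.
by exists (in_tuple (pmap insub w)).
Qed.

(** Deleting the square would give a shorter expression of p. *)
Lemma reduced_word_no_square (p : 'S_n) : ~ has_square (reduced_word p).
Proof.
move=> [u [i [v pE]]].
have lt_pred s : all (fun i => i.+1 < n)%N s = all (fun i => i < n.-1)%N s.
  by apply: eq_all => j; rewrite ltn_predRL.
have wn := reduced_word_lt p; rewrite lt_pred in wn.
have := wn; rewrite (braid_rewrites_all _ pE) all_cat /= => /and4P[un iP _ vn].
have: nat_word_perm (u ++ v) = p.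
  rewrite -[RHS]reduced_word_perm (braid_rewrites_perm pE wn) !nat_word_perm_cat.
  by rewrite !nat_word_perm_cons (mulgA (tau _)) tperm2 mul1g.
move/(congr1 (@perm_length n)); rewrite -(size_reduced_word p).
have := @perm_length_le (u ++ v); rewrite all_cat un vn => /(_ isT).
by rewrite (braid_rewrites_size pE) !size_cat /=; lia.
Qed.

Lemma reduced_word_normal (p : 'S_n) :
  exists2 u, u \in normal_words n & braid_rewrites (reduced_word p) u.
Proof.
by case: (normal_form (reduced_word_lt p)) => // /reduced_word_no_square.
Qed.

(** Every permutation has a normal word, by straightening a reduced one, and
    there are n! normal words; so each permutation has exactly one. *)
Lemma perm_normal_words : perm_eq (map nat_word_perm (normal_words n)) (enum 'S_n).
Proof.
have sub : {subset enum 'S_n <= map nat_word_perm (normal_words n)}.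
  move=> p _; have [u uW pu] := reduced_word_normal p.
  apply/mapP; exists u => //; rewrite -(braid_rewrites_perm pu) ?reduced_word_perm //.
  by apply: sub_all (reduced_word_lt p) => i; rewrite -ltn_predRL.
have sz : (size (map nat_word_perm (normal_words n)) <= size (enum 'S_n))%N.
  by rewrite size_map size_normal_words -cardE card_Sn.
have [eqm szE] := uniq_min_size (enum_uniq _) sub sz.
rewrite perm_sym; apply: (uniq_perm _ _ szE); first exact: enum_uniq.
by rewrite -(eq_uniq eqm szE) enum_uniq.
Qed.

(** The part of the theorem of Matsumoto that matters for Q_n: whatever
    reduced words have been chosen, the sum over the group is the sum over the
    normal words. *)
Lemma sum_reduced_words (X : nmodType) (f : seq nat -> X) :
  (forall s t, all (fun i => i.+1 < n)%N s -> braid_rewrites s t -> f s = f t) ->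
  (\sum_(p : 'S_n) f (reduced_word p) = \sum_(u <- normal_words n) f u)%R.
Proof.
move=> fE; pose g := nat_word_perm.
have g_inj : {in normal_words n &, injective g}.
  apply: uniq_map_inj_in; rewrite (perm_uniq perm_normal_words); exact: enum_uniq.
rewrite -big_enum /= -(perm_big _ perm_normal_words) big_map.
apply: eq_big_seq => u uW; have [v vW vE] := reduced_word_normal (g u).
rewrite (fE _ _ (reduced_word_lt _) vE); congr f; apply: g_inj => //.
rewrite -[RHS]reduced_word_perm [RHS](braid_rewrites_perm vE) //.
by apply: sub_all (reduced_word_lt _) => i; rewrite -ltn_predRL.
Qed.

End SymmetricGroup.

(** * Graded free algebras *)

Section Subspaces.
Variables (F : fieldType) (X : lmodType F) (J : set X).
Hypothesis subJ : subspace J.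
Local Open Scope ring_scope.

Lemma subspaceD x y : J x -> J y -> J (x + y).
Proof. by move=> Jx Jy; rewrite -[x]scale1r; apply: subJ.2. Qed.

Lemma subspaceZ a x : J x -> J (a *: x).
Proof. by move=> Jx; rewrite -[_ *: _]addr0; apply: subJ.2 => //; apply: subJ.1. Qed.

Lemma subspaceB x y : J x -> J y -> J (x - y).
Proof. by move=> Jx Jy; rewrite -scaleN1r addrC; apply: subJ.2. Qed.

Lemma subspace_sum (A : Type) (r : seq A) (P : pred A) (f : A -> X) :
  (forall i, P i -> J (f i)) -> J (\sum_(i <- r | P i) f i).
Proof. by move=> Jf; elim/big_rec: _ => [|i x /Jf]; [apply: subJ.1|apply: subspaceD]. Qed.

End Subspaces.

Section FreeAlgebra.
Variables (F : fieldType) (T : algType F) (I : finType).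
Local Open Scope ring_scope.

(** A free algebra on the finite set I, presented by its basis of words: linear
    maps can be defined on words, and linear statements checked on them. *)
Record free_algebra := FreeAlgebra {
  fa_word : seq I -> T;
  fa_lift : (seq I -> T) -> {linear T -> T};
  fword0 : fa_word [::] = 1;
  fword_cat : forall s t, fa_word (s ++ t) = fa_word s * fa_word t;
  lift_fword : forall h s, fa_lift h (fa_word s) = h s;
  fword_ind : forall P : T -> Prop,
    subspace P -> (forall s, P (fa_word s)) -> forall x, P x }.

Variable B : free_algebra.
Local Notation fword := (fa_word B).
Local Notation lift := (fa_lift B).
Implicit Types (x y z : T) (a b d : I) (s t : seq I).

(* Shows that an equation both sides of which are linear in one variable
   holds on a subspace. *)
Ltac linear_closed :=
  split; [by rewrite ?(mul0r, mulr0, linear0)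
         |let k := fresh in let p := fresh in let q := fresh in
          move=> k p q;
          rewrite ?(mulrDl, mulrDr, linearP, =^~ scalerAl, =^~ scalerAr) /=;
          by move=> -> ->; rewrite ?(scaler0, addr0)].

Definition hcomp n : {linear T -> T} :=
  lift (fun s => if size s == n then fword s else 0).

Definition deg n x := hcomp n x = x.

Lemma hcomp_fword n s : hcomp n (fword s) = if size s == n then fword s else 0.
Proof. by rewrite lift_fword. Qed.

Lemma deg_subspace n : subspace (deg n).
Proof. by rewrite /deg; linear_closed. Qed.

Lemma deg_fword s : deg (size s) (fword s).
Proof. by rewrite /deg hcomp_fword eqxx. Qed.

Lemma deg_ind n (P : T -> Prop) : subspace P ->
  (forall s, size s = n -> P (fword s)) -> forall x, deg n x -> P x.
Proof.
move=> Psub Pm x <-; elim/(@fword_ind B): x.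
  split=> [|k x y Px Py]; first by rewrite linear0; apply: Psub.1.
  by rewrite linearP; apply: Psub.2.
by move=> s; rewrite hcomp_fword; case: eqP => [/Pm//|_]; apply: Psub.1.
Qed.

Lemma deg_hcomp n x : deg n (hcomp n x).
Proof.
elim/(@fword_ind B): x; first by rewrite /deg; linear_closed.
move=> s; rewrite /deg hcomp_fword; case: eqP => sn; last by rewrite linear0.
by rewrite hcomp_fword sn eqxx.
Qed.

Lemma hcomp_deg m n x : deg m x -> hcomp n x = if m == n then x else 0.
Proof.
move=> xm; elim/deg_ind: xm => [|s <-]; last by rewrite hcomp_fword.
by case: eqP => _; linear_closed.
Qed.

Lemma deg_mul m n x y : deg m x -> deg n y -> deg (m + n)%N (x * y).
Proof.
move=> xm yn; elim/deg_ind: xm => [|s <-]; first by rewrite /deg; linear_closed.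
elim/deg_ind: yn => [|t <-]; first by rewrite /deg; linear_closed.
by rewrite -fword_cat -size_cat; apply: deg_fword.
Qed.

Lemma deg0_scalar x : deg 0 x -> exists k, x = k *: 1.
Proof.
move=> x0; elim/deg_ind: x0 => [|[|//] _]; last by exists 1; rewrite fword0 scale1r.
split=> [|k p q [l ->] [m ->]]; first by exists 0; rewrite scale0r.
by exists (k * l + m); rewrite scalerDl scalerA.
Qed.

Lemma deg_homo (f : {linear T -> T}) m n : (forall s, size s = m -> deg n (f (fword s))) ->
  forall x, deg m x -> deg n (f x).
Proof. by move=> fm; apply: deg_ind => //; rewrite /deg; linear_closed. Qed.

Definition letter a := fword [:: a].

Lemma deg_letter a : deg 1 (letter a).
Proof. exact: deg_fword. Qed.

Lemma fword_rcons s a : fword (rcons s a) = fword s * letter a.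
Proof. by rewrite -cats1 fword_cat. Qed.

(** Coordinates for the decomposition of the elements of positive degree
    according to their last letter, see [rcoef_sum]. *)
Definition rcoef a : {linear T -> T} := lift (fun s =>
  if rev s is b :: t then if b == a then fword (rev t) else 0 else 0).

Lemma rcoef_fword a s b : rcoef a (fword (rcons s b)) = if b == a then fword s else 0.
Proof. by rewrite lift_fword rev_rcons revK. Qed.

Lemma rcoef_letter a x b : rcoef a (x * letter b) = if b == a then x else 0.
Proof.
elim/(@fword_ind B): x; last by move=> s; rewrite -fword_rcons rcoef_fword.
by case: eqP => _; linear_closed.
Qed.

Lemma rcoef0 a x : deg 0 x -> rcoef a x = 0.
Proof.
move=> x0; elim/deg_ind: x0 => [|s]; first by linear_closed.
by move/size0nil=> ->; rewrite lift_fword.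
Qed.

Lemma rcoefM a n x y : deg n.+1 y -> rcoef a (x * y) = x * rcoef a y.
Proof.
move=> x0; elim/deg_ind: x0 => [|]; first by linear_closed.
elim/last_ind => // s b _ _; rewrite fword_rcons mulrA !rcoef_letter.
by case: eqP => _; rewrite ?mulr0.
Qed.

Lemma deg_rcoef a n x : deg n.+1 x -> deg n (rcoef a x).
Proof.
apply: deg_homo; elim/last_ind => // s b _; rewrite size_rcons => -[<-].
rewrite rcoef_fword; case: eqP => _; first exact: deg_fword.
exact: (deg_subspace _).1.
Qed.

Lemma rcoef_sum n x : deg n.+1 x -> x = \sum_a rcoef a x * letter a.
Proof.
move=> x0; elim/deg_ind: x0 => [|]; last first.
  elim/last_ind => // s b _ _; rewrite (bigD1 b) //= big1 => [|a /negPf ba].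
    by rewrite fword_rcons rcoef_letter eqxx addr0.
  by rewrite rcoef_fword eq_sym ba mul0r.
split=> [|k p q pE qE]; first by rewrite big1 // => a _; rewrite linear0 mul0r.
rewrite {1}pE {1}qE scaler_sumr -big_split /=; apply: eq_bigr => a _.
by rewrite linearP /= mulrDl scalerAl.
Qed.

(** * Braid group actions on a free algebra *)

(** The braid group on n strands acts on the component of degree n for every n;
    [gen_mull] and [gen_mulr] say that on a product of elements of degrees m
    and n the braids on the first m or the last n strands act on one factor
    only. *)
Record braid_action := BraidAction {
  ba_gen : nat -> {linear T -> T};
  deg_gen : forall i n x, deg n x -> deg n (ba_gen i x);
  gen_mull : forall i n x y,
    deg n x -> (i.+1 < n)%N -> ba_gen i (x * y) = ba_gen i x * y;
  gen_mulr : forall i n x y, deg n x -> ba_gen (n + i)%N (x * y) = x * ba_gen i y;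
  gen_far : forall i j x, (i.+1 < j)%N -> ba_gen i (ba_gen j x) = ba_gen j (ba_gen i x);
  gen_near : forall i n x, deg n x -> (i.+2 < n)%N ->
    ba_gen i (ba_gen i.+1 (ba_gen i x)) = ba_gen i.+1 (ba_gen i (ba_gen i.+1 x)) }.

Variable A : braid_action.
Local Notation gen := (ba_gen A).

Definition wact (w : seq nat) x := foldr (fun i => gen i) x w.

Lemma wact_linear w : linear (wact w).
Proof. by elim: w => // i w IHw k x y; rewrite /= IHw linearP. Qed.

HB.instance Definition _ w := GRing.isLinear.Build F T T *:%R (wact w) (wact_linear w).

Lemma wact_cat u v x : wact (u ++ v) x = wact u (wact v x).
Proof. by rewrite /wact foldr_cat. Qed.

Lemma deg_wact w n x : deg n x -> deg n (wact w x).
Proof. by elim: w => //= i w IHw /IHw; apply: deg_gen. Qed.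

Lemma wact_mull w n x y : deg n x -> all (fun i => i.+1 < n)%N w ->
  wact w (x * y) = wact w x * y.
Proof.
move=> xn; elim: w => //= i w IHw /andP[ltin /IHw ->].
by rewrite (gen_mull A _ _ ltin) //; apply: deg_wact.
Qed.

Lemma wact_mulr w n x y : deg n x -> wact [seq (n + i)%N | i <- w] (x * y) = x * wact w y.
Proof. by move=> xn; elim: w => //= i w ->; rewrite (gen_mulr A). Qed.

Lemma wact_rewrites u v n x : braid_rewrites u v -> deg n x ->
  all (fun i => i.+1 < n)%N u -> wact u x = wact v x.
Proof.
elim=> {u v} [//|u v w uv IHu _ IHv|u v i j ij|u v i] xn un.
- by rewrite IHu // IHv // -(braid_rewrites_all _ uv).
- rewrite !wact_cat /=; congr (wact u _).
  by case/orP: ij => ij; [|symmetry]; apply: gen_far.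
- move: un; rewrite all_cat /= => /and5P[_ i2n _ _ _].
  by rewrite !wact_cat /= (@gen_near A _ n) //; apply: deg_wact.
Qed.

Lemma descent_shift m n p : descent (m + n)%N (m + p)%N = [seq (m + i)%N | i <- descent n p].
Proof. by rewrite /descent subnDl iotaDl map_rev. Qed.

Lemma descent_lt m n p : (n <= m)%N -> all (fun i => i < m)%N (descent n p).
Proof. by move=> nm; apply/allP => i; rewrite mem_descent; lia. Qed.

(** The braiding of the letter b with x, written in T V. *)
Definition pass b : {linear T -> T} :=
  lift (fun s => wact (descent (size s) 0) (letter b * fword s)).

Lemma passE n b x : deg n x -> pass b x = wact (descent n 0) (letter b * x).
Proof.
move=> x0; elim/deg_ind: x0 => [|s <-]; last by rewrite lift_fword.
linear_closed.
Qed.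

Lemma deg_pass n b x : deg n x -> deg n.+1 (pass b x).
Proof. by move=> xn; rewrite (passE _ xn); apply/deg_wact/(deg_mul (deg_letter b)). Qed.

(** The matrix coefficients of the braiding V (x) T -> T (x) V. *)
Definition cross a b x := rcoef a (pass b x).

Lemma cross_linear a b : linear (cross a b).
Proof. by move=> k x y; rewrite /cross !linearP. Qed.

HB.instance Definition _ a b :=
  GRing.isLinear.Build F T T *:%R (cross a b) (cross_linear a b).

Lemma deg_cross n a b x : deg n x -> deg n (cross a b x).
Proof. by move/(deg_pass b); apply: deg_rcoef. Qed.

Lemma pass_sum n b x : deg n x -> pass b x = \sum_a cross a b x * letter a.
Proof. by move/(deg_pass b)/rcoef_sum. Qed.

Lemma wact_descentM n k x y : deg n.+1 x -> deg k y ->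
  wact (descent (n + k)%N n) (x * y) = \sum_d rcoef d x * pass d y.
Proof.
move=> xn yk; rewrite {1}(rcoef_sum xn) mulr_suml linear_sum /=; apply: eq_bigr => d _.
rewrite -mulrA -{2}[n]addn0 descent_shift (wact_mulr _ _ (deg_rcoef _ xn)).
by rewrite (passE _ yk).
Qed.

(** The letter b passes through x, leaves it as some letter d, and this letter
    passes through y. *)
Lemma crossM a b x y : cross a b (x * y) = \sum_d cross d b x * cross a d y.
Proof.
elim/(@fword_ind B): x => [|s].
  split=> [|k p q pE qE]; first by rewrite mul0r linear0 big1 // => d _; rewrite linear0 mul0r.
  rewrite mulrDl -scalerAl linearP /= pE qE scaler_sumr -big_split /=.
  by apply: eq_bigr => d _; rewrite linearP /= mulrDl scalerAl.
elim/(@fword_ind B): y => [|t].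
  split=> [|k p q pE qE]; first by rewrite mulr0 linear0 big1 // => d _; rewrite linear0 mulr0.
  rewrite mulrDr -scalerAr linearP /= pE qE scaler_sumr -big_split /=.
  by apply: eq_bigr => d _; rewrite linearP /= mulrDr scalerAr.
have sm := deg_fword s; have tn := deg_fword t; set m := size s in sm; set n := size t in tn.
have passM : pass b (fword s * fword t) = \sum_d cross d b (fword s) * pass d (fword t).
  rewrite (passE _ (deg_mul sm tn)).
  have -> : descent (m + n)%N 0 = descent (m + n)%N m ++ descent m 0.
    by rewrite /descent -rev_cat !subn0 addKn iotaD.
  rewrite wact_cat mulrA (wact_mull _ (deg_mul (deg_letter b) sm)) ?descent_lt //.
  by rewrite -(passE _ sm) (wact_descentM (deg_pass _ sm) tn).
rewrite [LHS]/cross passM linear_sum /=; apply: eq_bigr => d _.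
by rewrite (rcoefM _ _ (deg_pass _ tn)).
Qed.

Lemma cross_hcomp a b n x : cross a b (hcomp n x) = hcomp n (cross a b x).
Proof.
elim/(@fword_ind B): x; first by linear_closed.
move=> s; have sn := deg_fword s.
rewrite (hcomp_deg _ sn) (hcomp_deg _ (deg_cross a b sn)).
by case: eqP => // _; rewrite linear0.
Qed.

(** * Skew derivations *)

(** In degree n, the component of degree (n-1, 1) of the comultiplication,
    followed by the product. *)
Definition to_end : {linear T -> T} := lift (fun s =>
  \sum_(j < size s) wact (descent (size s).-1 j) (fword s)).

Lemma to_endE n x : deg n x -> to_end x = \sum_(j < n) wact (descent n.-1 j) x.
Proof.
move=> xn; elim/deg_ind: xn => [|s <-]; last by rewrite lift_fword.
split=> [|k p q pE qE]; first by rewrite linear0 big1 // => j _; rewrite linear0.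
rewrite linearP /= pE qE scaler_sumr -big_split /=.
by apply: eq_bigr => j _; rewrite linearP.
Qed.

Lemma deg_to_end n x : deg n x -> deg n (to_end x).
Proof.
move=> xn; rewrite (to_endE xn); apply: (subspace_sum (deg_subspace n)) => j _.
exact: deg_wact.
Qed.

Definition der a x := rcoef a (to_end x).

Lemma der_letter a b : der a (letter b) = (b == a)%:R.
Proof.
rewrite /der (to_endE (deg_letter b)) big_ord1 /= -[letter b]mul1r rcoef_letter.
by case: (b == a).
Qed.

Lemma der_linear a : linear (der a).
Proof. by move=> k x y; rewrite /der !linearP. Qed.

HB.instance Definition _ a := GRing.isLinear.Build F T T *:%R (der a) (der_linear a).

Lemma deg_der n a x : deg n.+1 x -> deg n (der a x).
Proof. by move/deg_to_end; apply: deg_rcoef. Qed.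

Lemma der0 a x : deg 0 x -> der a x = 0.
Proof. by move/deg_to_end; apply: rcoef0. Qed.

Lemma der_hcomp a n x : der a (hcomp n.+1 x) = hcomp n (der a x).
Proof.
elim/(@fword_ind B): x => [|s]; first by linear_closed.
have := deg_fword s; case: (size s) => [|m] sm; rewrite (hcomp_deg _ sm).
  by rewrite linear0 (der0 _ sm) linear0.
rewrite (hcomp_deg _ (deg_der a sm)) eqSS.
by case: eqP => // _; rewrite linear0.
Qed.

(** A letter of y is brought to the end of y without meeting x; a letter of x
    is first brought to the end of x, where it becomes some letter d, and then
    passes through y. *)
Lemma derM a x y : der a (x * y) = x * der a y + \sum_d der d x * cross a d y.
Proof.
elim/(@fword_ind B): x => [|s].
  split=> [|k p q pE qE].
    by rewrite !mul0r linear0 big1 ?addr0 // => d _; rewrite linear0 mul0r.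
  rewrite mulrDl -scalerAl linearP /= pE qE scalerDr addrACA mulrDl scalerAl.
  congr (_ + _); rewrite scaler_sumr -big_split /=.
  by apply: eq_bigr => d _; rewrite linearP /= mulrDl scalerAl.
elim/(@fword_ind B): y => [|t].
  split=> [|k p q pE qE].
    by rewrite !(mulr0, linear0) big1 ?addr0 // => d _; rewrite linear0 mulr0.
  rewrite mulrDr -scalerAr linearP /= pE qE scalerDr addrACA linearP mulrDr scalerAr.
  congr (_ + _); rewrite scaler_sumr -big_split /=.
  by apply: eq_bigr => d _; rewrite linearP /= mulrDr scalerAr.
have sm := deg_fword s; have tk := deg_fword t.
set k := size t in tk; move: (size s) sm => [|n] sn.
  (* In degree 0 the element x is a scalar. *)
  rewrite big1 => [|d _]; last by rewrite (der0 _ sn) mul0r.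
  have [l ->] := deg0_scalar sn.
  by rewrite addr0 -!scalerAl !mul1r linearZ.
have to_endM : to_end (fword s * fword t) =
    fword s * to_end (fword t) + \sum_d der d (fword s) * pass d (fword t).
  rewrite (to_endE (deg_mul sn tk)) big_split_ord /= addrC; congr (_ + _).
    rewrite (to_endE tk) mulr_sumr; apply: eq_bigr => j _.
    rewrite -(wact_mulr _ _ sn) -descent_shift; congr (wact (descent _ _) _).
    by case: (k) j => [[]//|k' _]; rewrite addnS.
  rewrite -(wact_descentM (deg_to_end sn) tk) (to_endE sn) mulr_suml linear_sum /=.
  apply: eq_bigr => j _; have jn : (j <= n)%N by rewrite -ltnS.
  have -> : descent (n + k)%N j = descent (n + k)%N n ++ descent n j.
    by rewrite /descent -rev_cat -addnBAC // iotaD subnKC // addKn.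
  by rewrite wact_cat (wact_mull _ sn) //; apply: sub_all (descent_lt j (leqnn n)) => i.
rewrite [LHS]/der to_endM linearD linear_sum /=; congr (_ + _).
  case: (k) tk => [|k'] tk; last by rewrite (rcoefM _ _ (deg_to_end tk)).
  rewrite (der0 _ tk) mulr0 (to_endE tk) big_ord0 mulr0; exact: linear0.
by apply: eq_bigr => d _; rewrite (rcoefM _ _ (deg_pass _ tk)).
Qed.

Lemma der_letterM a b x : der a (letter b * x) = letter b * der a x + cross a b x.
Proof.
rewrite derM (bigD1 b) //= der_letter eqxx mul1r big1 ?addr0 // => d /negPf db.
by rewrite der_letter eq_sym db mul0r.
Qed.

(** * Quantum symmetrizers and the Nichols ideal *)

Definition symmetrizer n x := \sum_(p : 'S_n) wact (reduced_word p) x.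

Lemma symmetrizer_linear n : linear (symmetrizer n).
Proof.
move=> k x y; rewrite /symmetrizer scaler_sumr -big_split /=.
by apply: eq_bigr => p _; rewrite linearP.
Qed.

HB.instance Definition _ n :=
  GRing.isLinear.Build F T T *:%R (symmetrizer n) (symmetrizer_linear n).

Lemma deg_symmetrizer n m x : deg n x -> deg n (symmetrizer m x).
Proof.
by move=> xn; apply: (subspace_sum (deg_subspace n)) => p _; apply: deg_wact.
Qed.

Lemma symmetrizer_normal n x : deg n x -> symmetrizer n x = \sum_(u <- normal_words n) wact u x.
Proof.
move=> xn; apply: (sum_reduced_words (f := fun u => wact u x)) => u v un uv.
exact: wact_rewrites un.
Qed.

Lemma symmetrizer_mull n x y : deg n x -> symmetrizer n (x * y) = symmetrizer n x * y.
Proof.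
move=> xn; rewrite /symmetrizer mulr_suml; apply: eq_bigr => p _.
by apply: wact_mull xn _; apply: reduced_word_lt.
Qed.

(** The normal words for n + 1 letters are products of a normal word for the
    first n letters with a descent, and the sum of all descents is
    [to_end]. *)
Lemma symmetrizerS n x : deg n.+1 x ->
  symmetrizer n.+1 x = \sum_a symmetrizer n (der a x) * letter a.
Proof.
move=> xn; have dn a := deg_der a xn.
transitivity (symmetrizer n (to_end x)); last first.
  rewrite (rcoef_sum (deg_to_end xn)) linear_sum; apply: eq_bigr => a _.
  exact: (symmetrizer_mull _ (dn a)).
rewrite (symmetrizer_normal xn) [LHS](@big_allpairs_dep _ _ _ _ _ _ (fun u p => u ++ descent n p)
  (normal_words n) (fun=> iota 0 n.+1)).
have -> : symmetrizer n (to_end x) = \sum_(u <- normal_words n) wact u (to_end x).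
  rewrite (rcoef_sum (deg_to_end xn)) linear_sum /=.
  rewrite [RHS](eq_bigr (fun u => \sum_a wact u (der a x * letter a))); last first.
    by move=> u _; rewrite linear_sum.
  rewrite [RHS]exchange_big /=; apply: eq_bigr => a _.
  rewrite (symmetrizer_mull _ (dn a)) (symmetrizer_normal (dn a)) mulr_suml.
  apply: eq_big_seq => u /normal_words_lt un; by rewrite (wact_mull _ (dn a)).
apply: eq_bigr => u _; rewrite (to_endE xn) linear_sum.
rewrite -[iota 0 n.+1]/(index_iota 0 n.+1) big_mkord.
by apply: eq_bigr => j _; rewrite wact_cat.
Qed.

Definition qker n x := deg n x /\ symmetrizer n x = 0.

Lemma qker_lt2 n x : (n < 2)%N -> qker n x -> x = 0.
Proof. by case: n => [|[|//]] _ [xn]; rewrite symmetrizer_normal // big_seq1. Qed.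

Lemma qker_subspace n : subspace (qker n).
Proof.
split; first by split; [apply: (deg_subspace n).1|rewrite linear0].
move=> k x y [xn xE] [yn yE]; split; first exact: (deg_subspace n).2.
by rewrite linearP /= xE yE scaler0 addr0.
Qed.

(** The recursive description of the kernels: the letters are linearly
    independent as right factors. *)
Lemma qkerS n x : deg n.+1 x -> (qker n.+1 x <-> forall a, qker n (der a x)).
Proof.
move=> xn; split=> [[_ xE] a|xE]; split=> //; first exact: deg_der.
  have := congr1 (rcoef a) xE; rewrite (symmetrizerS xn) linear0 linear_sum (bigD1 a) //=.
  rewrite rcoef_letter eqxx big1 ?addr0 // => b /negPf ba.
  by rewrite rcoef_letter ba.
by rewrite (symmetrizerS xn) big1 // => a _; rewrite (xE a).2 mul0r.
Qed.

(** Naturality of the braiding, for each of the braids in the sum. *)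
Lemma pass_symmetrizer n b x : deg n x -> symmetrizer n (pass b x) = pass b (symmetrizer n x).
Proof.
move=> xn; rewrite (passE _ (deg_symmetrizer n xn)) (passE _ xn) /symmetrizer mulr_sumr linear_sum.
apply: eq_bigr => p _ /=; have := reduced_word_lt p.
move: (reduced_word p) => u un.
rewrite -(wact_mulr _ _ (deg_letter b)) -!wact_cat; symmetry.
apply: (wact_rewrites (n := n.+1)); first exact: descent_pass.
  exact: (deg_mul (deg_letter b) xn).
rewrite all_cat descent_lt //= all_map.
by apply: sub_all un => i.
Qed.

Lemma qker_cross n a b x : qker n x -> qker n (cross a b x).
Proof.
move=> [xn xE]; split; first exact: deg_cross.
have := congr1 (rcoef a) (pass_symmetrizer b xn); rewrite xE !linear0.
rewrite (pass_sum _ xn) (linear_sum (symmetrizer n)) linear_sum (bigD1 a) //=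
  big1 => [|d /negPf da].
  by rewrite (symmetrizer_mull _ (deg_cross _ _ xn)) rcoef_letter eqxx addr0.
by rewrite (symmetrizer_mull _ (deg_cross _ _ xn)) rcoef_letter da.
Qed.

Definition two_sided (J : set T) :=
  subspace J /\ forall x y, J y -> J (x * y) /\ J (y * x).

Definition der_closed (J : set T) := forall a x, J x -> J (der a x).

Definition cross_closed (J : set T) := forall a b x, J x -> J (cross a b x).

Definition generated (G : set T) : set T :=
  fun x => forall J, two_sided J -> (forall y, G y -> J y) -> J x.

Lemma generated_sub G x : G x -> generated G x.
Proof. by move=> Gx J _; apply. Qed.

Lemma generated_ideal G : two_sided (generated G).
Proof.
split; first split.
- by move=> J [Jsub _] _; apply: Jsub.1.
- move=> k x y xG yG J Jid GJ; have [Jsub _] := Jid.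
  by apply: Jsub.2; [apply: xG|apply: yG].
- move=> x y yG; split=> J Jid GJ; have [_ Jmul] := Jid.
    by have [] := Jmul x y (yG J Jid GJ).
  by have [] := Jmul x y (yG J Jid GJ).
Qed.

(** By the product rules, the elements of the ideal on which all these
    operators take values in the ideal form an ideal themselves. *)
Lemma generated_closed G :
  (forall a x, G x -> generated G (der a x)) ->
  (forall a b x, G x -> generated G (cross a b x)) ->
  der_closed (generated G) /\ cross_closed (generated G).
Proof.
move=> derG crossG; set J := generated G.
have [Jsub Jmul] : two_sided J := generated_ideal G.
have JL x y : J y -> J (x * y) by move=> Jy; have [] := Jmul x y Jy.
have JR x y : J y -> J (y * x) by move=> Jy; have [] := Jmul x y Jy.
have Jsum (f : I -> T) : (forall i, J (f i)) -> J (\sum_i f i).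
  by move=> Jf; apply: (subspace_sum Jsub).
suff sub x : J x -> [/\ J x, forall a, J (der a x) & forall a b, J (cross a b x)].
  by split=> [a x /sub[] //|a b x /sub[]].
move=> xG; pose P z := [/\ J z, forall a, J (der a z) & forall a b, J (cross a b z)].
apply: (xG P); last first.
  by move=> {xG}x Gx; split=> *; [apply: generated_sub|apply: derG|apply: crossG].
split; first split.
- by split=> [|a|a b]; rewrite ?linear0; apply: Jsub.1.
- move=> k {xG}x y [Jx dx px] [Jy dy py].
  split=> [|a|a b]; [exact: Jsub.2|rewrite linearP|rewrite linearP].
    exact: Jsub.2 (dx a) (dy a).
  exact: Jsub.2 (px a b) (py a b).
move=> {xG}x y [Jy dy py]; split; split=> [|a|a b]; try by [apply: JL|apply: JR].
- rewrite derM; apply: (subspaceD Jsub); first exact: JL.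
  by apply: Jsum => d; apply: JL.
- by rewrite crossM; apply: Jsum => d; apply: JL.
- rewrite derM; apply: (subspaceD Jsub); first exact: JR.
  by apply: Jsum => d; apply: JR.
- by rewrite crossM; apply: Jsum => d; apply: JR.
Qed.

(** By [qkerS], membership in the kernels is decided after enough derivations,
    which lead to elements of degree 0. *)
Lemma der_closed_sub_qker (S : set T) : subspace S -> der_closed S ->
  (forall x, S x -> hcomp 0 x = 0) -> forall x, S x -> forall n, qker n (hcomp n x).
Proof.
move=> Ssub Sder S0 x Sx n; elim: n x Sx => [|n IHn] x Sx.
  by rewrite S0 //; apply: (qker_subspace 0).1.
apply/(qkerS (deg_hcomp _ _)) => a; rewrite der_hcomp.
exact/IHn/Sder.
Qed.

(** Modulo J the Leibniz rule reads d_a (x y) = x d_a (y), so that induction on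
    the degree of y reduces to the case of a constant y. *)
Lemma mul_mem_qker (J : set T) x : two_sided J -> der_closed J ->
  (forall a, J (der a x)) -> ~ J x ->
  forall n y, deg n y -> J (x * y) -> qker n y.
Proof.
move=> [Jsub Jmul] Jder Jdx nJx; elim=> [|n IHn] y yn Jxy.
  have [k yE] := deg0_scalar yn; rewrite yE in Jxy *.
  case: (eqVneq k 0) => [->|k0]; first by rewrite scale0r; apply: (qker_subspace 0).1.
  case: nJx; rewrite -[x]scale1r -(mulVf k0) -scalerA; apply: (subspaceZ Jsub).
  by rewrite -scalerAr mulr1 in Jxy.
apply/(qkerS yn) => a; apply: IHn; first exact: deg_der.
have := Jder a _ Jxy; rewrite derM => Jd.
have Js : J (\sum_d der d x * cross a d y).
  by apply: (subspace_sum Jsub) => d _; have [] := Jmul (cross a d y) _ (Jdx d).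
by have := subspaceB Jsub Jd Js; rewrite addrK.
Qed.

Lemma ideal_deg_ge (J : set T) m : two_sided J -> (forall x, deg m x -> J x) ->
  forall n x, (m <= n)%N -> deg n x -> J x.
Proof.
move=> [Jsub Jmul] Jm n x mn xn; elim/deg_ind: xn => // s sn.
rewrite -(cat_take_drop m s) fword_cat.
have [|//] := Jmul (fword (drop m s)) (fword (take m s)).
by apply: Jm; have := deg_fword (take m s); rewrite size_takel // sn.
Qed.

(** An element x of K_n outside J, with n minimal, has its derivatives in
    K_(n-1), hence in J; then [mul_mem_qker] contradicts the choice of y. *)
Lemma qker_sub_ideal (J : set T) n0 k y : two_sided J -> der_closed J ->
  (forall n x, (n < n0)%N -> qker n x -> J x) ->
  deg k y -> ~ qker k y ->
  (forall n x, (n0 <= n)%N -> deg n x -> J (x * y)) ->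
  forall n x, qker n x -> J x.
Proof.
move=> Jid Jder Jlow yk yN Jxy n; elim/ltn_ind: n => n IHn x xK.
case: (ltnP n n0) => [/Jlow|n0n]; first exact.
apply: contrapT => nJx; apply: yN.
apply: (mul_mem_qker Jid Jder _ nJx yk); last exact: Jxy n0n xK.1.
case: n {n0n} IHn xK => [|n] IHn xK a.
  by rewrite (der0 _ xK.1); apply: Jid.1.1.
by apply: (IHn n) => //; apply: (qkerS xK.1).1.
Qed.

(** In degrees 0 and 1 the kernels are zero by [qker_lt2], which makes the
    definition uniform in n. *)
Definition nichols : set T := fun x => forall n, qker n (hcomp n x).

Lemma hcomp_qker n m x : qker n x -> qker m (hcomp m x).
Proof.
move=> xK; rewrite (hcomp_deg m xK.1); case: eqP => [<- //|_].
exact: (qker_subspace m).1.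
Qed.

Lemma hcomp0M x y : hcomp 0 (x * y) = hcomp 0 x * hcomp 0 y.
Proof.
elim/(@fword_ind B): x => [|s]; first by linear_closed.
elim/(@fword_ind B): y => [|t]; first by linear_closed.
rewrite (hcomp_deg _ (deg_mul (deg_fword s) (deg_fword t))) !hcomp_fword addn_eq0.
by case: eqP => _; case: eqP => _; rewrite ?(mul0r, mulr0).
Qed.

Lemma generated_nichols (G : set T) :
  (forall x, G x -> nichols x) ->
  (forall a x, G x -> generated G (der a x)) ->
  (forall a b x, G x -> generated G (cross a b x)) ->
  forall x, generated G x -> nichols x.
Proof.
move=> GN derG crossG; have [Jd Jp] := generated_closed derG crossG.
apply: der_closed_sub_qker => //; first by have [] := generated_ideal G.
move=> x xG; apply: (xG (fun z => hcomp 0 z = 0)) => [|y /GN/(_ 0%N)/(qker_lt2 (n := 0) isT) //].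
split; first by linear_closed.
by move=> {xG}x y y0; rewrite !hcomp0M y0 mulr0 mul0r.
Qed.

(** The generators of the r-th approximation of the Nichols ideal, together
    with zero components in the degrees above r. *)
Definition nichols_le r : set T := fun x =>
  forall n, if (n <= r)%N then qker n (hcomp n x) else hcomp n x = 0.

Lemma nichols_leW r x : nichols_le r x -> nichols x.
Proof.
move=> xG n; have := xG n; case: ifP => // _ ->; exact: (qker_subspace n).1.
Qed.

Lemma nichols_le_der r a x : nichols_le r x -> nichols_le r (der a x).
Proof.
move=> xG n; rewrite -der_hcomp; have := xG n.+1; case: (leqP n.+1 r) => [nr|_ ->].
  by move/(qkerS (deg_hcomp _ _))/(_ a) => xK; rewrite (ltnW nr).
by rewrite linear0; case: ifP => // _; apply: (qker_subspace n).1.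
Qed.

Lemma nichols_le_cross r a b x : nichols_le r x -> nichols_le r (cross a b x).
Proof.
move=> xG n; rewrite -cross_hcomp; have := xG n; case: ifP => _ xn.
  exact: qker_cross.
by rewrite xn linear0.
Qed.

Lemma qker_nichols_le r n x : (n <= r)%N -> qker n x -> nichols_le r x.
Proof.
move=> nr xK m; rewrite (hcomp_deg m xK.1); case: (n =P m) => [<-|_].
  by rewrite nr.
by case: ifP => // _; apply: (qker_subspace m).1.
Qed.

Lemma qker_ge2 (b : bool) n x :
  (if (2 <= n)%N && b then qker n x else x = 0) <-> (if b then qker n x else x = 0).
Proof.
case: (ltnP n 2) => n2 //=; case: b => //; split=> [->|/(qker_lt2 n2) //].
exact: (qker_subspace n).1.
Qed.

Definition approx r := generated (nichols_le r).

Lemma approx_two_sided r : two_sided (approx r).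
Proof. exact: generated_ideal. Qed.

Lemma approx_der r : der_closed (approx r).
Proof.
apply: (generated_closed _ _).1 => [a x|a b x] xG; apply: generated_sub.
  exact: nichols_le_der.
exact: nichols_le_cross.
Qed.

Lemma approx_nichols r x : approx r x -> nichols x.
Proof.
apply: generated_nichols => [y|a y|a b y] yG; first exact: nichols_leW yG.
  by apply: generated_sub; apply: nichols_le_der.
by apply: generated_sub; apply: nichols_le_cross.
Qed.

Lemma qker_low_approx r n x : (n <= r)%N -> qker n x -> approx r x.
Proof. by move=> nr xK; apply: generated_sub; apply: qker_nichols_le xK. Qed.

(** If some y of degree r is outside K_r, multiplication by it carries the
    degrees above r to degrees where everything vanishes; otherwise the
    quotient already vanishes in degree r. *)
Lemma qker_sub_approx r : (forall x, deg (2 * r).+1 x -> approx r x) ->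
  forall n x, qker n x -> approx r x.
Proof.
move=> van; have Jid := approx_two_sided r.
case: (pselect (exists2 y, deg r y & ~ qker r y)) => [[y yr yK]|noy].
  apply: (qker_sub_ideal (n0 := r.+1) Jid (@approx_der r) _ yr yK) => n x nr.
    exact: qker_low_approx.
  move=> xn; apply: (ideal_deg_ge Jid van _ (deg_mul xn yr)); lia.
move=> n x xK; case: (leqP n r) => [/qker_low_approx|/ltnW rn]; first exact.
apply: (ideal_deg_ge Jid _ rn xK.1) => y yr.
apply: (qker_low_approx (leqnn r)); apply: contrapT => yK.
by apply: noy; exists y.
Qed.

(** Multiplication by an element of top degree carries all elements of positive
    degree into J. *)
Lemma qker_sub_top (J : set T) k y : two_sided J -> der_closed J ->
  deg k y -> ~ qker k y -> (forall n x, (k < n)%N -> deg n x -> J x) ->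
  forall n x, qker n x -> J x.
Proof.
move=> Jid Jder yk yK Jtop; apply: (qker_sub_ideal (n0 := 1) Jid Jder _ yk yK).
  move=> n x n1 xK; have -> : x = 0 by apply: qker_lt2 xK; lia.
  exact: Jid.1.1.
by move=> n x n1 xn; apply: (Jtop _ _ _ (deg_mul xn yk)); lia.
Qed.

(** Almost all homogeneous components of x vanish, and x is their sum. *)
Lemma mem_hcomp (J : set T) x : subspace J -> (forall n, J (hcomp n x)) -> J x.
Proof.
move=> Jsub Jx.
suff [M xE] : exists M, forall m, (M <= m)%N -> x = \sum_(n < m) hcomp n x.
  by rewrite (xE M (leqnn M)); apply: (subspace_sum Jsub) => n _.
elim/(@fword_ind B): {Jx}x => [|s].
  split=> [|k p q [M pE] [N qE]].
    by exists 0%N => m _; rewrite big1 // => n _; rewrite linear0.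
  exists (maxn M N) => m; rewrite geq_max => /andP[/pE {1}-> /qE {1}->].
  by rewrite scaler_sumr -big_split; apply: eq_bigr => n _; rewrite linearP.
exists (size s).+1 => m sm; rewrite (bigD1 (Ordinal sm)) //= big1.
  by rewrite hcomp_fword eqxx addr0.
by move=> n; rewrite hcomp_fword -val_eqE /= eq_sym => /negPf ->.
Qed.

End FreeAlgebra.

(** * Braid group actions given by a braiding of two letters *)

Section LocalBraiding.
Variables (F : fieldType) (T : algType F) (I : finType) (B : free_algebra T I).
Variable braided_pair : I -> I -> T.
Hypothesis deg_braided_pair : forall a b, deg B 2 (braided_pair a b).
Local Notation fword := (fa_word B).
Local Open Scope ring_scope.

(** The operator with value [braided_pair a b] on two adjacent letters a b, in
    the positions i and i + 1; it is the identity on shorter words. *)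
Definition local_gen (i : nat) : {linear T -> T} := fa_lift B (fun s =>
  if drop i s is a :: b :: t then fword (take i s) * braided_pair a b * fword t
  else fword s).

Lemma local_gen_fword u a b t :
  local_gen (size u) (fword (u ++ a :: b :: t)) = fword u * braided_pair a b * fword t.
Proof. by rewrite /local_gen lift_fword drop_size_cat // take_size_cat. Qed.

Lemma local_gen_short i n x : deg B n x -> (n <= i.+1)%N -> local_gen i x = x.
Proof.
move=> xn ni; elim/deg_ind: xn => [|s sn].
  by split=> [|k p q pE qE]; rewrite ?linear0 // linearP /= pE qE.
rewrite -sn in ni; rewrite /local_gen lift_fword.
have := size_drop i s; case: (drop i s) => [//|a [//|b t]] /= sE.
by exfalso; lia.
Qed.

Lemma split_long i (s : seq I) : (i.+1 < size s)%N ->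
  exists u a b t, size u = i /\ s = u ++ a :: b :: t.
Proof.
move=> si; have := size_drop i s.
case sE: (drop i s) => [|a [|b t]] /= sz; try by exfalso; lia.
exists (take i s), a, b, t; rewrite size_takel; last by lia.
by rewrite -sE cat_take_drop.
Qed.

Lemma local_gen_mull i n x y : deg B n x -> (i.+1 < n)%N -> local_gen i (x * y) = local_gen i x * y.
Proof.
move=> xn ltin; elim/deg_ind: xn => [|s sn].
  split=> [|k p q pE qE]; first by rewrite !(mul0r, linear0).
  by rewrite mulrDl -scalerAl !linearP /= pE qE mulrDl -scalerAl.
elim/(@fword_ind _ _ _ B): y => [|v].
  split=> [|k p q pE qE]; first by rewrite !(mulr0, linear0).
  by rewrite mulrDr -scalerAr linearP /= pE qE mulrDr -scalerAr.
rewrite -sn in ltin; have [u [a [b [t [<- ->]]]]] := split_long ltin.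
by rewrite -fword_cat -catA /= !local_gen_fword fword_cat mulrA.
Qed.

Lemma local_gen_mulr i n x y : deg B n x -> local_gen (n + i)%N (x * y) = x * local_gen i y.
Proof.
move=> xn; elim/deg_ind: xn => [|u un].
  split=> [|k p q pE qE]; first by rewrite !(mul0r, linear0).
  by rewrite mulrDl -scalerAl !linearP /= pE qE mulrDl -scalerAl.
elim/(@fword_ind _ _ _ B): y => [|s].
  split=> [|k p q pE qE]; first by rewrite !(mulr0, linear0).
  by rewrite mulrDr -scalerAr !linearP /= pE qE mulrDr -scalerAr.
rewrite -fword_cat; case: (leqP (size s) i.+1) => si.
  rewrite (local_gen_short (deg_fword B s) si) (local_gen_short (deg_fword B _)) ?fword_cat //.
  by rewrite size_cat; lia.
have [v [a [b [t [vi ->]]]]] := split_long si.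
rewrite -vi local_gen_fword -un -size_cat catA local_gen_fword fword_cat.
by rewrite -!mulrA.
Qed.

Lemma deg_local_gen i n x : deg B n x -> deg B n (local_gen i x).
Proof.
apply: deg_homo => s sn; case: (leqP (size s) i.+1) => si.
  by rewrite (local_gen_short (deg_fword B s) si) -sn; apply: deg_fword.
have [v [a [b [t [vi sE]]]]] := split_long si.
have -> : n = (size v + 2 + size t)%N by rewrite -sn sE size_cat /=; lia.
rewrite -vi sE local_gen_fword; apply: deg_mul; last exact: deg_fword.
by apply: deg_mul => //; apply: deg_fword.
Qed.

Lemma local_gen_far i j x : (i.+1 < j)%N ->
  local_gen i (local_gen j x) = local_gen j (local_gen i x).
Proof.
move=> ij; elim/(@fword_ind _ _ _ B): x => [|s].
  split=> [|k p q pE qE]; first by rewrite !linear0.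
  by rewrite !linearP /= pE qE.
case: (leqP j (size s)) => sj; last first.
  have sd := deg_fword B s.
  rewrite (local_gen_short sd) ?(local_gen_short (deg_local_gen i sd)) //; lia.
rewrite -(cat_take_drop j s) fword_cat; have := size_takel sj.
move: (take j s) (drop j s) => u v uj; have ud := deg_fword B u; rewrite uj in ud.
(* The right factor v begins at position j, where the second operator acts. *)
have gen0 x y : deg B j x -> local_gen j (x * y) = x * local_gen 0 y.
  by move=> xd; rewrite -{1}[j]addn0; apply: local_gen_mulr.
by rewrite gen0 // !(local_gen_mull _ ud ij) gen0 //; apply: deg_local_gen.
Qed.

Hypothesis yang_baxter : forall x, deg B 3 x ->
  local_gen 0 (local_gen 1 (local_gen 0 x)) = local_gen 1 (local_gen 0 (local_gen 1 x)).

(** The three operators involved act on the letters in the positions i, i + 1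
    and i + 2 only, so that the equation in degree 3 is enough. *)
Lemma local_gen_near i n x : deg B n x -> (i.+2 < n)%N ->
  local_gen i (local_gen i.+1 (local_gen i x)) = local_gen i.+1 (local_gen i (local_gen i.+1 x)).
Proof.
move=> xn i2n; elim/deg_ind: xn => [|s sn].
  split=> [|k p q pE qE]; first by rewrite !linear0.
  by rewrite !linearP /= pE qE.
have [u [v [t [ui v3 ->]]]] : exists u v t, [/\ size u = i, size v = 3 & s = u ++ v ++ t].
  exists (take i s), (take 3 (drop i s)), (drop 3 (drop i s)).
  by rewrite !cat_take_drop !size_takel ?size_drop //; lia.
have ud := deg_fword B u; rewrite ui in ud.
have vd := deg_fword B v; rewrite v3 in vd.
have loc k z : (k < 2)%N -> deg B 3 z ->
    local_gen (i + k)%N (fword u * (z * fword t)) = fword u * (local_gen k z * fword t).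
  by move=> k2 zd; rewrite (local_gen_mulr _ _ ud) (local_gen_mull _ zd).
have loc0 z : deg B 3 z ->
    local_gen i (fword u * (z * fword t)) = fword u * (local_gen 0 z * fword t).
  by move=> zd; rewrite -(loc 0%N) // addn0.
have loc1 z : deg B 3 z ->
    local_gen i.+1 (fword u * (z * fword t)) = fword u * (local_gen 1 z * fword t).
  by move=> zd; rewrite -(loc 1%N) // addn1.
by rewrite !fword_cat !(loc0, loc1) ?yang_baxter //; do ?apply: deg_local_gen.
Qed.

Definition local_braid_action : braid_action B :=
  BraidAction deg_local_gen local_gen_mull local_gen_mulr local_gen_far local_gen_near.

End LocalBraiding.

(** * Linear functions on monoid algebras *)

Section LinearFunctions.
Variables (F : fieldType) (X Y Z : lmodType F).
Local Open Scope ring_scope.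

Lemma linear_compose (f : Y -> Z) (g : X -> Y) :
  linear f -> linear g -> linear (fun x => f (g x)).
Proof. by move=> fL gL k x y; rewrite gL fL. Qed.

Lemma scale_linear (k : F) : linear (fun x : X => k *: x).
Proof. by move=> a x y; rewrite scalerDr !scalerA mulrC. Qed.

Lemma mcoeff_scale_linear (K : choiceType) (k : K) (y : Y) :
  linear (fun x : {malg F[K]} => x@_k *: y).
Proof. by move=> a p q; rewrite mcoeffD mcoeffZ scalerDl scalerA. Qed.

Lemma linear_fun (f : {linear X -> Y}) : linear f.
Proof. exact: linearP. Qed.

Lemma linear_id : linear (fun x : X => x).
Proof. by []. Qed.

Lemma linear_zero : linear (fun _ : X => 0 : Y).
Proof. by move=> a x y; rewrite scaler0 addr0. Qed.

Lemma linearD_eq (f : X -> Y) x y : linear f -> f (x + y) = f x + f y.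
Proof. by move=> fL; have := fL 1 x y; rewrite !scale1r. Qed.

Lemma linear_sum_eq (f : X -> Y) n (x : 'I_n -> X) :
  linear f -> f (\sum_i x i) = \sum_i f (x i).
Proof.
move=> fL; apply: (big_morph f (fun x y => linearD_eq x y fL)).
by have := fL (-1) 0 0; rewrite !scaleN1r !addNr.
Qed.

Lemma mull_linear (A : algType F) (a : A) : linear (fun x : A => a * x).
Proof. by move=> k x y; rewrite mulrDr scalerAr. Qed.

Lemma subspace_eq (f g : X -> Y) :
  linear f -> linear g -> subspace (fun x => f x = g x).
Proof.
move=> fL gL; split=> [|a x y xE yE]; last by rewrite fL gL xE yE.
have := fL (-1) 0 0; have := gL (-1) 0 0.
by rewrite !scaler0 !addr0 !scaleN1r !addNr => -> ->.
Qed.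

End LinearFunctions.

Section LinearExtension.
Variables (F : fieldType) (K : choiceType) (X : lmodType F).
Local Open Scope ring_scope.

Lemma linext_fset (h : K -> X) (D : {fset K}) (x : {malg F[K]}) :
  {subset msupp x <= D} -> linext h x = \sum_(k <- D) x@_k *: h k.
Proof.
move=> sub; apply: big_fset_incl => [|k _ kx]; first exact/fsubsetP.
by rewrite mcoeff_outdom ?scale0r.
Qed.

Lemma linext_is_linear (h : K -> X) : linear (linext h).
Proof.
move=> a x y; pose D := (msupp x `|` msupp y)%fset.
have xD : {subset msupp x <= D} by move=> k kx; rewrite inE kx.
have yD : {subset msupp y <= D} by move=> k ky; rewrite inE ky orbT.
have aD : {subset msupp (a *: x + y) <= D}.
  move=> k; rewrite -mcoeff_neq0 mcoeffD mcoeffZ; apply: contraR.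
  rewrite inE negb_or => /andP[kx ky].
  by rewrite !mcoeff_outdom // mulr0 addr0.
rewrite !(linext_fset _ aD, linext_fset _ xD, linext_fset _ yD).
rewrite scaler_sumr -big_split; apply: eq_bigr => k _ /=.
by rewrite mcoeffD mcoeffZ scalerDl scalerA.
Qed.

HB.instance Definition _ (h : K -> X) :=
  GRing.isLinear.Build F {malg F[K]} X *:%R (linext h) (linext_is_linear h).

Lemma linextU (h : K -> X) k : linext h << k >> = h k.
Proof. by rewrite /linext msuppU oner_eq0 big_seq_fset1 mcoeffUU scale1r. Qed.

Lemma malgUZ (a : F) (k : K) : << a *g k >> = a *: << k >> :> {malg F[K]}.
Proof. by apply/malgP => l; rewrite mcoeffZ !mcoeffU mulrnAr mulr1. Qed.

Lemma malg_ind (P : {malg F[K]} -> Prop) : subspace P ->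
  (forall k, P << k >>) -> forall x, P x.
Proof.
move=> [P0 Plin] Pk x; rewrite (monalgE x).
elim/big_rec: _ => // k y _ Py.
by rewrite malgUZ; apply: Plin.
Qed.

Lemma eq_linext (h1 h2 : K -> X) : h1 =1 h2 -> linext h1 =1 linext h2.
Proof. by move=> hE x; apply: eq_bigr => k _; rewrite hE. Qed.

End LinearExtension.

Section SupportRestriction.
Variables (F : fieldType) (K : choiceType).
Local Open Scope ring_scope.

Lemma mcoeff_linext_if (P : pred K) (x : {malg F[K]}) k :
  P k -> (linext (fun l => if P l then << l >> : {malg F[K]} else 0) x)@_k = x@_k.
Proof.
move=> Pk; set h := (X in linext X).
have hL : linear (linext h) := linext_is_linear h.
move: x; apply: (malg_ind (P := fun x => (linext h x)@_k = x@_k)).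
  apply: (@subspace_eq _ _ F^o) => a x y; last by rewrite mcoeffD mcoeffZ.
  by rewrite hL mcoeffD mcoeffZ.
move=> l; rewrite linextU /h; case: (boolP (P l)) => [//|nPl].
rewrite mcoeff0 mcoeffU; by case: eqP nPl => // ->; rewrite Pk.
Qed.

End SupportRestriction.

Section MonoidAlgebra.
Variables (F : fieldType) (K : monomType).
Local Open Scope ring_scope.
Implicit Types (x y : {malg F[K]}) (k : F).

Lemma malgU_mul (u v : K) : << u >> * << v >> = << mmul u v >> :> {malg F[K]}.
Proof. by rewrite malgM_def fgmulUU mulr1. Qed.

(** Scalars commute with the basis, hence with everything. *)
Lemma malg_scalerAr k x y : k *: (x * y) = x * (k *: y).
Proof.
have comm : forall x, x * k%:MP = k *: x :> {malg F[K]}.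
  apply: (malg_ind (P := fun x => x * k%:MP = k *: x)); last first.
    by move=> w; rewrite malgM_def fgmulUU mulm1 mul1r; apply: malgUZ.
  split=> [|a p q pE qE]; first by rewrite mul0r scaler0.
  by rewrite mulrDl -scalerAl pE qE scalerDr !scalerA [a * k]mulrC.
by rewrite -[in RHS]mul_malgC mulrA comm scalerAl.
Qed.

Definition malg_algType : algType F :=
  HB.pack {malg F[K]} (GRing.Lalgebra_isAlgebra.Build F {malg F[K]} malg_scalerAr).

End MonoidAlgebra.

(** * The tensor algebra of a braided vector space *)

Section TensorAlgebra.
Variables (F : fieldType) (V : vectType F).
Local Open Scope ring_scope.

Local Notation I := 'I_(\dim {:V}).
Local Notation W := (word V).
Local Notation T := (tensor_alg F V).
Local Notation TT := (tensor_alg2 F V).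

Definition tensor_algType : algType F := malg_algType F W.

Definition tensor_word (s : seq I) : tensor_algType := << FMonom s >> : T.

Definition tensor_lift (h : seq I -> tensor_algType) :
    {linear tensor_algType -> tensor_algType} :=
  linext (fun w : W => h w).

Lemma FMonomK (w : W) : FMonom (w : seq I) = w.
Proof. by case: w. Qed.

Lemma tensor_word0 : tensor_word [::] = 1.
Proof.
apply: (congr1 (fun w : W => << w >> : T)).
by rewrite -[RHS]FMonomK fm1.
Qed.

Lemma tensor_word_cat s t : tensor_word (s ++ t) = tensor_word s * tensor_word t.
Proof.
rewrite /tensor_word [RHS](@malgU_mul F W (FMonom s) (FMonom t)).
by congr << _ >>; rewrite -[RHS]FMonomK fmM.
Qed.

Lemma tensor_lift_word h s : tensor_lift h (tensor_word s) = h s.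
Proof. exact: linextU. Qed.

Lemma tensor_word_ind (P : tensor_algType -> Prop) :
  subspace P -> (forall s, P (tensor_word s)) -> forall x, P x.
Proof.
move=> Psub Pw; apply: (malg_ind (P := P) Psub) => w; rewrite -(FMonomK w).
exact: Pw.
Qed.

Definition tensor_free : free_algebra tensor_algType I :=
  FreeAlgebra tensor_word0 tensor_word_cat tensor_lift_word tensor_word_ind.

Lemma component_linext n (x : T) :
  component n x = linext (fun w : W => if size w == n then << w >> : T else 0) x.
Proof.
rewrite /component big_mkcond; apply: eq_bigr => w _.
by case: (size w == n); [apply: malgUZ|rewrite scaler0].
Qed.

Lemma componentE n (x : T) : component n x = hcomp tensor_free n x.
Proof.
rewrite component_linext.
change (linext (fun w : W => if size w == n then << w >> : T else 0) x =
  linext (fun w : W => if size w == n then tensor_word w else 0) x).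
by apply: eq_linext => w; rewrite /tensor_word FMonomK.
Qed.

Lemma TpowE n (x : T) : Tpow n x <-> deg tensor_free n x.
Proof. by rewrite /Tpow /deg /= componentE. Qed.

Lemma deg_inT (v : V) : deg tensor_free 1 (inT v).
Proof.
apply: (subspace_sum (deg_subspace tensor_free 1)) => i _.
apply: (subspaceZ (deg_subspace tensor_free 1)); exact: (deg_letter tensor_free).
Qed.

Lemma deg_inT2 (t : tensor F V V) : deg tensor_free 2 (inT2 t).
Proof.
apply: (subspace_sum (deg_subspace tensor_free 2)) => i _.
apply: (subspace_sum (deg_subspace tensor_free 2)) => j _.
apply: (subspaceZ (deg_subspace tensor_free 2)).
exact: (deg_mul (deg_inT _) (deg_inT _)).
Qed.

Variable c : 'End(tensor F V V).

Definition braided_pair (a b : I) : tensor_algType := inT2 (c (tens (basis_vec a) (basis_vec b))).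

Lemma deg_braided_pair a b : deg tensor_free 2 (braided_pair a b).
Proof. exact: deg_inT2. Qed.

Lemma sigmaE i (x : T) : sigma c i x = local_gen tensor_free braided_pair i x.
Proof.
change (sigma c i x = linext (fun w : W =>
  if drop i w is a :: b :: t then tensor_word (take i w) * braided_pair a b * tensor_word t
  else tensor_word w) x).
apply: eq_linext => w; rewrite /tensor_word FMonomK.
by case: (drop i w) => [//|a [//|b t]].
Qed.

Hypothesis braided_c : braided c.

Lemma yang_baxter (x : tensor_algType) : deg tensor_free 3 x ->
  let g := local_gen tensor_free braided_pair in
  g 0%N (g 1%N (g 0%N x)) = g 1%N (g 0%N (g 1%N x)).
Proof.
move=> /TpowE/braided_c.2.
have E i : sigma c i = local_gen tensor_free braided_pair i :> (T -> T) by apply/funext/sigmaE.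
rewrite (E 0%N) (E 1%N).
apply.
Qed.

Definition tensor_action : braid_action tensor_free :=
  local_braid_action deg_braided_pair yang_baxter.

Lemma braid_actE s (x : T) : braid_act c s x = wact tensor_action s x.
Proof.
elim: s => [//|i s IHs].
change (sigma c i (braid_act c s x) =
  local_gen tensor_free braided_pair i (wact tensor_action s x)).
move: (braid_act c s x) (wact tensor_action s x) IHs => y z ->.
exact: sigmaE.
Qed.

Lemma qsymE n (x : T) : qsym c n x = symmetrizer tensor_action n x.
Proof. by apply: eq_bigr => p _; apply: braid_actE. Qed.

Lemma ker_qsymE n (x : T) : ker_qsym c n x <-> qker tensor_action n x.
Proof. by rewrite /ker_qsym /qker /= qsymE TpowE. Qed.

Lemma ker_qsym_ifE (b : bool) n (x : T) :
  (if b then ker_qsym c n else [set 0]%classic) x <->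
  (if b then qker tensor_action n x else x = 0 :> tensor_algType).
Proof. by case: b; [apply: ker_qsymE|]. Qed.

Lemma nichols_idealE (x : T) : nichols_ideal c x <-> nichols tensor_action x.
Proof.
split=> xN n.
  have := xN n; rewrite componentE -[(2 <= n)%N]andbT.
  by move=> /ker_qsym_ifE/qker_ge2.
rewrite componentE -[(2 <= n)%N]andbT.
apply/ker_qsym_ifE/qker_ge2; exact: xN.
Qed.

(** * The comultiplication and the skew derivations *)

Local Notation X := (letter tensor_free).

(** The coefficient of the word t in the second tensor factor. *)
Definition cut (t : W) (z : TT) : T :=
  linext (fun p : W * W => if p.2 == t then << p.1 >> : T else 0) z.

Lemma cut_pair t (u v : W) : cut t << (u, v) >> = if v == t then << u >> else 0.
Proof. by rewrite /cut linextU. Qed.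

Lemma cut_linear t : linear (cut t).
Proof. exact: linext_is_linear. Qed.

Lemma wordE (w : W) : << w >> = tensor_word w :> T.
Proof. by rewrite /tensor_word FMonomK. Qed.

Lemma tensT_word (u : W) (y : T) :
  tensT << u >> y = linext (fun v => << (u, v) >> : TT) y.
Proof. exact: linextU. Qed.

Lemma tensT_pair (u v : W) : tensT << u >> << v >> = << (u, v) >> :> TT.
Proof. by rewrite tensT_word linextU. Qed.

Lemma tensT_linearr (u : W) : linear (fun y : T => tensT << u >> y : TT).
Proof. by move=> k x y; rewrite !tensT_word; apply: linext_is_linear. Qed.

Lemma cut_tensT t (x y : T) : cut t (tensT x y) = y@_t *: x.
Proof.
move: x; apply: (malg_ind (P := fun x => cut t (tensT x y) = y@_t *: x)).
  apply: (@subspace_eq _ _ T); last exact: scale_linear.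
  exact: (linear_compose (@cut_linear t) (linext_is_linear _)).
move=> u; move: y; apply: (malg_ind (P := fun y => cut t (tensT << u >> y) = y@_t *: << u >>)).
  apply: (@subspace_eq _ _ T); last exact: mcoeff_scale_linear.
  exact: (linear_compose (@cut_linear t) (@tensT_linearr u)).
move=> v; rewrite tensT_pair cut_pair mcoeffU1.
by case: (v == t); rewrite ?scale1r ?scale0r.
Qed.

Definition mulTT_basis (p : W * W) : TT -> TT := linext (fun q : W * W =>
    linext (fun r : W * W => << (mmul p.1 r.1, mmul r.2 q.2) >> : TT)
      (braidT c << (p.2, q.1) >>)).

Lemma mulTT_pair p z : mulTT c << p >> z = mulTT_basis p z.
Proof. by rewrite /mulTT linextU. Qed.

Lemma mulTT_basis_linear p : linear (mulTT_basis p).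
Proof. exact: linext_is_linear. Qed.

Lemma mulTT_basis_pair p q : mulTT_basis p << q >> =
  linext (fun r : W * W => << (mmul p.1 r.1, mmul r.2 q.2) >> : TT)
      (braidT c << (p.2, q.1) >>).
Proof. by rewrite /mulTT_basis linextU. Qed.

Lemma size_word0 : size (mone : W) = 0%N.
Proof. by rewrite fm1. Qed.

Lemma braidT_one (u : W) : braidT c << (mone, u) >> = << (u, mone) >>.
Proof.
rewrite /braidT linextU size_word0 mul1m /split_at linextU take_size drop_size.
by rewrite FMonomK -[mone]FMonomK fm1.
Qed.

Lemma braidT_letter b (u : W) : braidT c << (FMonom [:: b], u) >> =
  split_at (size u) (pass tensor_action b << u >>).
Proof.
have uE : deg tensor_free (size u) (<< u >> : T) by rewrite wordE; apply: (deg_fword tensor_free).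
rewrite /braidT linextU /= /block_braid /= cats0; congr split_at.
rewrite (passE tensor_action b uE) braid_actE /descent subn0; congr (wact tensor_action _ _).
exact: esym (@malgU_mul F W (FMonom [:: b]) u).
Qed.

Lemma mulTT_basis_one w (u v : W) :
  mulTT_basis (w, mone) << (u, v) >> = << (mmul w u, v) >>.
Proof.
rewrite mulTT_basis_pair braidT_one linextU.
by apply: (congr1 (fun x : W => << (mmul w u, x) >> : TT)); apply: mul1m.
Qed.

Lemma cut_mulTT_linear t p : linear (fun z => cut t (mulTT_basis p z)).
Proof. exact: (linear_compose (@cut_linear t) (@mulTT_basis_linear p)). Qed.

Lemma cut_mul_left t b z :
  cut t (mulTT_basis (FMonom [:: b], mone) z) = X b * (cut t z : tensor_algType).
Proof.
move: z; apply: (malg_ind (P := fun z =>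
    cut t (mulTT_basis (FMonom [:: b], mone) z) = X b * (cut t z : tensor_algType))).
  apply: (@subspace_eq _ _ T); first exact: cut_mulTT_linear.
  exact: (linear_compose (@mull_linear _ tensor_algType (X b)) (@cut_linear t)).
move=> [u v]; rewrite mulTT_basis_one.
apply: etrans (cut_pair _ _ _) _.
apply: etrans (esym (congr1 (fun z : tensor_algType => X b * z) (cut_pair t u v))).
case: (v == t); last exact: esym (@mulr0 tensor_algType _).
exact: esym (@malgU_mul F W (FMonom [:: b]) u).
Qed.

Lemma word_nil : FMonom [::] = mone :> W.
Proof. by rewrite -[RHS]FMonomK fm1. Qed.

Lemma FMonomM (s t : seq I) : mmul (FMonom s) (FMonom t) = FMonom (s ++ t) :> W.
Proof. by rewrite -[LHS]FMonomK fmM. Qed.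

Lemma FMonom_eq (s t : seq I) : (FMonom s == FMonom t :> W) = (s == t).
Proof. by rewrite fmP. Qed.

Definition mul_right (v : W) : TT -> TT :=
  linext (fun r : W * W => << (mmul mone r.1, mmul r.2 v) >> : TT).

Lemma linear_sum_rcoef (P : pred I) :
  linear (fun y : tensor_algType => \sum_(d | P d) rcoef tensor_free d y).
Proof.
move=> k x y; rewrite scaler_sumr -big_split /=; apply: eq_bigr => d _.
exact: linearP.
Qed.

(** Splitting off the last letter of y and multiplying the second factor by v
    gives t for exactly those last letters d with d v = t. *)
Lemma cut_split_at n t (v : W) (y : T) : deg tensor_free n.+1 y ->
  cut t (mul_right v (split_at n y)) =
    \sum_(d | mmul (FMonom [:: d]) v == t) rcoef tensor_free d y.
Proof.
move=> yn; elim/deg_ind: yn => [|].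
  apply: (@subspace_eq _ T T).
    apply: (linear_compose (@cut_linear t)).
    exact: (linear_compose (linext_is_linear _) (linext_is_linear _)).
  exact: linear_sum_rcoef.
elim/last_ind => // s d _; rewrite size_rcons => -[sn].
rewrite big_mkcond (bigD1 d) //= big1 => [|b /negPf bd]; last first.
  by rewrite [X in if _ then X else _](rcoef_fword tensor_free b s d) [d == b]eq_sym bd if_same.
rewrite (rcoef_fword tensor_free d s d) eqxx addr0.
rewrite /split_at /mul_right linextU /= -cats1 take_cat drop_cat sn ltnn subnn /= cats0.
by rewrite linextU cut_pair /= mul1m.
Qed.

Lemma mulTT_basis_letter b (u v : W) :
  mulTT_basis (mone, FMonom [:: b]) << (u, v) >> =
    mul_right v (split_at (size u) (pass tensor_action b << u >>)).
Proof. by rewrite mulTT_basis_pair braidT_letter. Qed.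

Lemma deg_pass_word b (u : W) :
  deg tensor_free (size u).+1 (pass tensor_action b (<< u >> : T)).
Proof. by apply: deg_pass; rewrite wordE; apply: (deg_fword tensor_free). Qed.

(** Multiplication by 1 (x) b lets b pass through the first factor u, which it
    leaves as some letter in front of the second factor v; the result is the
    word a iff v is empty and this letter is a. *)
Lemma cut_mul_right a b z :
  cut (FMonom [:: a]) (mulTT_basis (mone, FMonom [:: b]) z) =
    cross tensor_action a b (cut mone z).
Proof.
move: z; apply: (malg_ind (P := fun z =>
  cut (FMonom [:: a]) (mulTT_basis (mone, FMonom [:: b]) z) =
    cross tensor_action a b (cut mone z))).
  apply: (@subspace_eq _ _ T); first exact: cut_mulTT_linear.
  exact: (linear_compose (linear_fun (cross tensor_action a b)) (@cut_linear mone)).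
move=> [u v]; rewrite mulTT_basis_letter (cut_split_at _ _ (deg_pass_word b u)) cut_pair.
rewrite -(FMonomK v) -word_nil FMonom_eq.
under eq_bigl => d do rewrite FMonomM FMonom_eq eqseq_cons.
case: (_ == [::]).
  by rewrite (big_pred1 a) // => d; rewrite andbT.
by rewrite big_pred0 ?linear0 // => d; rewrite andbF.
Qed.

Lemma cut0_mul_right b z : cut mone (mulTT_basis (mone, FMonom [:: b]) z) = 0.
Proof.
move: z; apply: (malg_ind (P := fun z =>
  cut mone (mulTT_basis (mone, FMonom [:: b]) z) = 0)).
  by apply: (@subspace_eq _ _ T); [apply: cut_mulTT_linear|apply: linear_zero].
move=> [u v]; rewrite mulTT_basis_letter (cut_split_at _ _ (deg_pass_word b u)).
by rewrite big_pred0 // => d; rewrite -(FMonomK v) -word_nil FMonomM FMonom_eq.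
Qed.

Lemma mulTT_addl (x y z : TT) : mulTT c (x + y) z = mulTT c x z + mulTT c y z.
Proof.
have mulTT_linear : linear (fun x : TT => mulTT c x z) by exact: linext_is_linear.
exact: (linearD_eq x y mulTT_linear).
Qed.

Lemma cut_add t (x y : TT) : cut t (x + y) = cut t x + cut t y.
Proof. exact: (linearD_eq x y (@cut_linear t)). Qed.

Lemma comul_word (w : W) : comul c << w >> = foldr (fun i =>
  mulTT c (tensT << FMonom [:: i] >> 1 + tensT 1 << FMonom [:: i] >>)) (tensT 1 1) w.
Proof. exact: linextU. Qed.

Lemma comul_cons b s : comul c << FMonom (b :: s) >> =
  mulTT_basis (FMonom [:: b], mone) (comul c << FMonom s >>) +
  mulTT_basis (mone, FMonom [:: b]) (comul c << FMonom s >>).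
Proof.
have -> : comul c << FMonom (b :: s) >> =
    mulTT c (tensT << FMonom [:: b] >> 1 + tensT 1 << FMonom [:: b] >>)
      (comul c << FMonom s >>).
  by rewrite !comul_word.
rewrite mulTT_addl.
have -> : tensT << FMonom [:: b] >> 1 = << (FMonom [:: b], mone) >> :> TT.
  exact: tensT_pair.
have -> : tensT 1 << FMonom [:: b] >> = << (mone, FMonom [:: b]) >> :> TT.
  exact: tensT_pair.
exact: (congr2 (fun x y : TT => x + y)
  (mulTT_pair (FMonom [:: b], mone) (comul c << FMonom s >>))
  (mulTT_pair (mone, FMonom [:: b]) (comul c << FMonom s >>))).
Qed.

Lemma comul_linear : linear (comul c).
Proof. exact: linext_is_linear. Qed.

Lemma comul_nil : comul c << FMonom [::] >> = << (mone, mone) >>.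
Proof. by rewrite comul_word; apply: tensT_pair. Qed.

Lemma cut0_comul (x : T) : cut mone (comul c x) = x.
Proof.
move: x; apply: (malg_ind (P := fun x => cut mone (comul c x) = x)).
  apply: (@subspace_eq _ T T); last exact: linear_id.
  exact: (linear_compose (@cut_linear mone) comul_linear).
move=> w; rewrite -(FMonomK w); elim: (w : seq I) => [|b s IHs].
  by rewrite comul_nil cut_pair eqxx word_nil.
rewrite comul_cons cut_add.
rewrite [X in _ + X]cut0_mul_right addr0 cut_mul_left IHs.
exact: esym (tensor_word_cat [:: b] s).
Qed.

(** Both sides satisfy the same recursion on words, [comul_cons] on the left
    and [der_letterM] on the right. *)
Lemma cut1_comul a (x : T) : cut (FMonom [:: a]) (comul c x) = der tensor_action a x.
Proof.
move: x; apply: (malg_ind (P := fun x =>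
    cut (FMonom [:: a]) (comul c x) = der tensor_action a x)).
  apply: (@subspace_eq _ T T).
    exact: (linear_compose (@cut_linear (FMonom [:: a])) comul_linear).
  exact: (linear_fun (der tensor_action a)).
move=> w; rewrite -(FMonomK w); elim: (w : seq I) => [|b s IHs].
  rewrite comul_nil cut_pair -word_nil FMonom_eq.
  exact: esym (der0 tensor_action a (deg_fword tensor_free [::])).
rewrite comul_cons cut_add.
have left := etrans (cut_mul_left (FMonom [:: a]) b (comul c << FMonom s >>))
  (congr1 (fun z : tensor_algType => X b * z) IHs).
have right := etrans (cut_mul_right a b (comul c << FMonom s >>))
  (congr1 (cross tensor_action a b) (cut0_comul << FMonom s >>)).
apply: etrans (congr2 (fun x y : tensor_algType => x + y) left right) _.
apply: etrans (esym (der_letterM tensor_action a b (tensor_word s))) _.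
change (der tensor_action a (tensor_word [:: b] * tensor_word s) =
  der tensor_action a (tensor_word ([:: b] ++ s))).
exact: (congr1 (fun x : tensor_algType => der tensor_action a x) (esym (tensor_word_cat [:: b] s))).
Qed.

Lemma component_coeff (w : W) (x : T) : (component (size w) x)@_w = x@_w.
Proof.
rewrite component_linext.
exact: (mcoeff_linext_if (P := fun v : W => size v == size w)).
Qed.

(** In an element of J (x) T + T (x) J the coefficient of a letter on the right
    comes from J (x) T alone, since J has no part of degree 1. *)
Lemma coideal_der_closed (J : set T) :
  (J `<=` nichols_ideal c)%classic -> coideal c J -> der_closed tensor_action J.
Proof.
move=> JN [Jsub _ Jcomul] a x /Jcomul[y [z [[m [y1 [y2 [Jy _ ->]]]] [n [z1 [z2 [_ Jz ->]]]] xE]]].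
have cutL := @cut_linear (FMonom [:: a]).
rewrite -cut1_comul xE (linearD_eq _ _ cutL) !(linear_sum_eq _ cutL).
apply: (subspaceD Jsub); apply: (subspace_sum Jsub) => i _; rewrite cut_tensT.
  exact/(subspaceZ Jsub)/Jy.
have -> : (z2 i)@_(FMonom [:: a]) = 0.
  rewrite -component_coeff.
  by have /= := JN _ (Jz i) 1%N; move=> ->; rewrite mcoeff0.
rewrite scale0r; exact: Jsub.1.
Qed.

(** * Comparison of the quotients with the Nichols algebra *)

Lemma ideal_two_sided (J : set T) : ideal J -> two_sided (J : set tensor_algType).
Proof. by []. Qed.

Lemma approx_idealE r (x : T) : approx_ideal c r x <-> approx tensor_action r x.
Proof.
have gensE z : direct_sum (fun n => if (2 <= n <= r)%N then ker_qsym c n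
    else [set 0]%classic) z <-> nichols_le tensor_action r z.
  split=> zG n; first by have := zG n; rewrite componentE => /ker_qsym_ifE/qker_ge2.
  by rewrite componentE; apply/ker_qsym_ifE/qker_ge2; exact: zG.
split=> xJ J Jid GJ; apply: xJ => // z /gensE; exact: GJ.
Qed.

Lemma approx_ideal_eq r : approx_ideal c r = approx tensor_action r.
Proof. by apply/predeqP => x; apply: approx_idealE. Qed.

Lemma quotient_vanishesE (J : set T) n :
  quotient_vanishes J n <-> forall x, deg tensor_free n x -> J x.
Proof.
by split=> Jn x /TpowE /Jn; rewrite /congr_mod subr0.
Qed.

(** In degree n the Nichols ideal is K_n. *)
Lemma nonvanishing_nichols n : ~ quotient_vanishes (nichols_ideal c) n ->
  exists2 y, deg tensor_free n y & ~ qker tensor_action n y.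
Proof.
move=> nv; apply: contrapT => noy; apply: nv => x /TpowE xn.
rewrite /congr_mod subr0; apply/nichols_idealE => m; apply: (hcomp_qker (n := n)).
by apply: contrapT => xK; apply: noy; exists x.
Qed.

Lemma projection_iso_nichols (J : set T) : subspace J ->
  (forall x, J x -> nichols tensor_action x) ->
  (forall n x, qker tensor_action n x -> J x) ->
  projection_iso J (nichols_ideal c).
Proof.
move=> Jsub JN KJ x y; split=> [/JN/nichols_idealE //|/nichols_idealE xyN].
by apply: (mem_hcomp (B := tensor_free) Jsub) => n; apply: KJ (xyN n).
Qed.

Lemma top_degree_iso (J : set T) n : ideal J -> der_closed tensor_action J ->
  (forall x, J x -> nichols tensor_action x) ->
  quotient_top_degree J n -> ~ quotient_vanishes (nichols_ideal c) n ->
  projection_iso J (nichols_ideal c).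
Proof.
move=> Jid Jder JN [_ top] /nonvanishing_nichols[y yn yK].
apply: projection_iso_nichols => //; first exact: Jid.1.
apply: (qker_sub_top (ideal_two_sided Jid) Jder yn yK) => m x nm.
apply: (quotient_vanishesE J m).1; apply: contrapT => /top.
by rewrite leqNgt nm.
Qed.

Theorem approx_iso_of_vanishing r :
  quotient_vanishes (approx_ideal c r) (2 * r)%N.+1 ->
  projection_iso (approx_ideal c r) (nichols_ideal c).
Proof.
rewrite approx_ideal_eq => /quotient_vanishesE van.
apply: projection_iso_nichols.
- exact: (approx_two_sided tensor_action r).1.
- exact: (@approx_nichols _ _ _ _ tensor_action r).
- exact: (@qker_sub_approx _ _ _ _ tensor_action r).
Qed.

Theorem coideal_iso_of_top_degree (J : set T) n :
  (J `<=` nichols_ideal c)%classic -> ideal J -> coideal c J ->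
  quotient_top_degree J n -> ~ quotient_vanishes (nichols_ideal c) n ->
  projection_iso J (nichols_ideal c).
Proof.
move=> JN Jid Jco; apply: (top_degree_iso Jid).
  exact: coideal_der_closed.
by move=> x /JN/nichols_idealE.
Qed.

Theorem approx_iso_of_top_degree r n :
  quotient_top_degree (approx_ideal c r) n ->
  ~ quotient_vanishes (nichols_ideal c) n ->
  projection_iso (approx_ideal c r) (nichols_ideal c).
Proof.
rewrite approx_ideal_eq; apply: top_degree_iso.
- exact: (approx_two_sided tensor_action r).
- exact: (@approx_der _ _ _ _ tensor_action r).
- exact: (@approx_nichols _ _ _ _ tensor_action r).
Qed.

End TensorAlgebra.

Local Open Scope classical_set_scope.

Theorem theorem6p4 (R : realType) (V : vectType R[i]) (c : 'End(tensor R[i] V V)) :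
  braided c -> rigid c ->
  [/\ (forall r : nat, (2 <= r)%N ->
         quotient_vanishes (approx_ideal c r) (2 * r).+1 ->
         projection_iso (approx_ideal c r) (nichols_ideal c)),
      (forall J : set (tensor_alg R[i] V), J `<=` nichols_ideal c ->
         ideal J -> homogeneous J -> coideal c J -> braid_compatible c J ->
         quotient_findim J ->
         forall n : nat, quotient_top_degree J n ->
         ~ quotient_vanishes (nichols_ideal c) n ->
         projection_iso J (nichols_ideal c)) &
      (forall r : nat, (2 <= r)%N ->
         quotient_findim (approx_ideal c r) ->
         forall n : nat, quotient_top_degree (approx_ideal c r) n ->
         ~ quotient_vanishes (nichols_ideal c) n ->
         projection_iso (approx_ideal c r) (nichols_ideal c))].
Proof.
move=> cb _; split=> [r _|J JN Jid _ Jco _ _ n|r _ _ n].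
- exact: approx_iso_of_vanishing.
- exact: coideal_iso_of_top_degree.
- exact: approx_iso_of_top_degree.
Qed.
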